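(* There is a number $s_0\in(1/12,1/11)$ such that $L(a,b)\le\lambda_s(a,b)\le I(a,b)$ for all $a,b>0$ whenever $s_0\le s\le 1$. These bounds are best possible: the inequality $L(a,b)\le\lambda_s(a,b)$ holds for all $a,b>0$ if and only if $s\ge s_0$, and the inequality $\lambda_s(a,b)\le I(a,b)$ holds for all $a,b>0$ if and only if $s\le 1$.
   Context: For $a,b>0$ with $a\neq b$ define $$\lambda_s(a,b)=\begin{cases}\dfrac{s-1}{s+1}\cdot\dfrac{a^{s+1}+b^{s+1}-2\left(\frac{a+b}{2}\right)^{s+1}}{a^s+b^s-2\left(\frac{a+b}{2}\right)^s}, & s\in\mathbb{R}\setminus\{-1,0,1\},\\[3mm] \dfrac{2\log\frac{a+b}{2}-\log a-\log b}{\frac{1}{2a}+\frac{1}{2b}-\frac{2}{a+b}}, & s=-1,\\[3mm] \dfrac{a\log a+b\log b-(a+b)\log\frac{a+b}{2}}{2\log\frac{a+b}{2}-\log a-\log b}, & s=0,\\[3mm] \dfrac{(b-a)^2}{4\left(a\log a+b\log b-(a+b)\log\frac{a+b}{2}\right)}, & s=1,\end{cases}$$ and $\lambda_s(a,a)=a$. The logarithmic mean is $L(a,b)=\frac{b-a}{\log b-\log a}$ and the identric mean is $I(a,b)=\frac1e\,(b^b/a^a)^{1/(b-a)}$ for $a\ne b$, with $L(a,a)=I(a,a)=a$. *)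

(* Defs.v *)
From Stdlib Require Import Reals.
Open Scope R_scope.

Definition amean (a b : R) : R := (a + b) / 2.

Definition lambda_ne (s a b : R) : R :=
  if Req_EM_T s (-1) then
    (2 * ln (amean a b) - ln a - ln b) /
    (1 / (2 * a) + 1 / (2 * b) - 2 / (a + b))
  else if Req_EM_T s 0 then
    (a * ln a + b * ln b - (a + b) * ln (amean a b)) /
    (2 * ln (amean a b) - ln a - ln b)
  else if Req_EM_T s 1 then
    (b - a) ^ 2 / (4 * (a * ln a + b * ln b - (a + b) * ln (amean a b)))
  else
    (s - 1) / (s + 1) *
    ((Rpower a (s + 1) + Rpower b (s + 1) - 2 * Rpower (amean a b) (s + 1)) /
     (Rpower a s + Rpower b s - 2 * Rpower (amean a b) s)).

Definition lambda (s a b : R) : R :=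
  if Req_EM_T a b then a else lambda_ne s a b.

Definition logmean (a b : R) : R :=
  if Req_EM_T a b then a else (b - a) / (ln b - ln a).

Definition identric (a b : R) : R :=
  if Req_EM_T a b then a
  else / exp 1 * Rpower (Rpower b b / Rpower a a) (/ (b - a)).

(* Main.v *)
Require Import Defs.
From Stdlib Require Import Reals.
From Stdlib Require Import Lra Lia ZArith List.
From Coquelicot Require Import Coquelicot.
Import ListNotations.
Open Scope R_scope.

(** Let [f_s] be a function with [f_s''(x) = x^(s-2)] and
    [phi_s(a,b) = f_s(a) + f_s(b) - 2 f_s((a+b)/2)]; then [lambda_s = phi_(s+1) / phi_s] for every
    [s], the exceptional ones included. Convexity of a combination of such functions shows that
    [lambda_s] increases with [s], so the upper bound reduces to [lambda_1 <= I] and to a Taylor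
    expansion at [a = b], and [s0] is the infimum of the [s] with [L <= lambda_s].

    The bounds on [s0] come from failure at [s = 2/23], seen at [a = (4/5)^23, b = 1], and from
    [L <= lambda_s] at [s = 29/320]. For the latter put [a = 1 - t], [b = 1 + t]: the inequality
    says that a power series in [t^2] is nonnegative. Some of its coefficients are negative, but
    all its partial sums of coefficients are nonnegative, which suffices by Abel summation. *)

(** * Monotonicity in the parameter *)

(** The two bounds differ in kind. At [a = 1 - t], [b = 1 + t] the means [L], [I] and [lambda_s]
    expand as [1 - t^2/3], [1 - t^2/6] and [1 + (s - 2) t^2/6]. The upper threshold 1 is therefore
    visible at [a = b], but there [lambda_1] and [I] agree to second order, so [lambda_1 <= I] needs
    a global argument. For the lower bound the expansion allows every [s > 0], and as [a] tends to 0
    the mean [L] tends to 0 while [lambda_s] keeps a positive limit for [0 < s < 1]. For small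
    positive [s] any failure occurs strictly in between, so neither end determines [s0]; it is
    enclosed by explicit numerical estimates at two rational parameters, with [1/12 < 2/23] and
    [29/320 < 1/11] giving the strict bounds. *)

Lemma Rpower_pos (x y : R) : 0 < Rpower x y.
Proof. apply exp_pos. Qed.

Lemma is_derive_Rpower_base (r x : R) :
  0 < x -> is_derive (fun y => Rpower y r) x (r * Rpower x (r - 1)).
Proof.
  intros Hx. unfold Rpower. auto_derive; [exact Hx|].
  replace ((r - 1) * ln x) with (r * ln x + - ln x) by ring.
  rewrite exp_plus, exp_Ropp, exp_ln by exact Hx. field. lra.
Qed.

Definition boxcox (r x : R) : R :=
  if Req_EM_T r 0 then ln x else (Rpower x r - 1) / r.

(** This is the [f_s] of the overview, normalised so that its derivative is [boxcox (s - 1)] in all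
    three cases. The linear term which this requires cancels in every [gap]. *)
Definition potential (s x : R) : R :=
  if Req_EM_T s 0 then x - ln x
  else if Req_EM_T s 1 then x * ln x - x
  else (Rpower x s / s - x) / (s - 1).

Lemma is_derive_boxcox (r x : R) :
  0 < x -> is_derive (boxcox r) x (Rpower x (r - 1)).
Proof.
  intros Hx. unfold boxcox. destruct (Req_EM_T r 0) as [->|Hr].
  - replace (Rpower x (0 - 1)) with (/ x).
    + auto_derive; [exact Hx|ring].
    + replace (0 - 1) with (- (1)) by ring. rewrite Rpower_Ropp, Rpower_1; auto.
  - apply is_derive_ext with (fun y => / r * (Rpower y r + - 1)).
    { intros y. simpl. field. exact Hr. }
    evar_last.
    + apply is_derive_scal. apply @is_derive_plus.
      * apply is_derive_Rpower_base, Hx.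
      * apply @is_derive_const.
    + unfold plus, zero. simpl. field. exact Hr.
Qed.

Lemma is_derive_potential (s x : R) :
  0 < x -> is_derive (potential s) x (boxcox (s - 1) x).
Proof.
  intros Hx. unfold potential, boxcox.
  destruct (Req_EM_T s 0) as [->|H0].
  - destruct (Req_EM_T (0 - 1) 0) as [E|_]; [lra|].
    replace (0 - 1) with (- (1)) by ring. rewrite Rpower_Ropp, Rpower_1 by exact Hx.
    auto_derive; [exact Hx|field; lra].
  - destruct (Req_EM_T s 1) as [->|H1].
    + destruct (Req_EM_T (1 - 1) 0) as [_|E]; [|lra].
      auto_derive; [exact Hx|field; lra].
    + destruct (Req_EM_T (s - 1) 0) as [E|_]; [lra|].
      apply is_derive_ext with (fun y => / (s - 1) * (/ s * Rpower y s + - y)).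
      { intros y. simpl. field. split; lra. }
      evar_last.
      * apply is_derive_scal. apply @is_derive_plus.
        -- apply is_derive_scal, is_derive_Rpower_base, Hx.
        -- apply @is_derive_opp, @is_derive_id.
      * unfold plus, opp, one. simpl. field. split; lra.
Qed.

Definition gap (h : R -> R) (a b : R) : R := h a + h b - 2 * h ((a + b) / 2).

Lemma gap_sym (h : R -> R) (a b : R) : gap h a b = gap h b a.
Proof. unfold gap. rewrite (Rplus_comm b a). ring. Qed.

(** The two halves of [[a, b]] have equal length, so the gap is a difference of two values of [h1]
    times that length, and the mean value theorem applies once more. The factor [k] absorbs the
    lengths: only the sign of [h2] at some positive point matters later. *)
Lemma gap_lt_mvt (h h1 h2 : R -> R) (a b : R) :
  (forall x, 0 < x -> is_derive h x (h1 x)) ->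
  (forall x, 0 < x -> is_derive h1 x (h2 x)) ->
  0 < a < b -> exists c k, 0 < c /\ 0 < k /\ gap h a b = h2 c * k.
Proof.
  intros D1 D2 [Ha Hab]. unfold gap. set (m := (a + b) / 2).
  assert (Hm : a < m < b) by (unfold m; lra).
  destruct (MVT_cor2 h h1 a m) as (c1 & E1 & I1); [lra| |].
  { intros x Hx. apply is_derive_Reals, D1. lra. }
  destruct (MVT_cor2 h h1 m b) as (c2 & E2 & I2); [lra| |].
  { intros x Hx. apply is_derive_Reals, D1. lra. }
  destruct (MVT_cor2 h1 h2 c1 c2) as (c & E & I); [lra| |].
  { intros x Hx. apply is_derive_Reals, D2. lra. }
  exists c, ((c2 - c1) * ((b - a) / 2)). split; [lra|]. split.
  { apply Rmult_lt_0_compat; lra. }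
  replace (h a + h b - 2 * h m) with ((h b - h m) - (h m - h a)) by ring.
  rewrite E1, E2. replace (b - m) with ((b - a) / 2) by (unfold m; field).
  replace (m - a) with ((b - a) / 2) by (unfold m; field).
  rewrite <- Rmult_minus_distr_r, E. ring.
Qed.

Lemma gap_mvt (h h1 h2 : R -> R) (a b : R) :
  (forall x, 0 < x -> is_derive h x (h1 x)) ->
  (forall x, 0 < x -> is_derive h1 x (h2 x)) ->
  0 < a -> 0 < b -> a <> b -> exists c k, 0 < c /\ 0 < k /\ gap h a b = h2 c * k.
Proof.
  intros D1 D2 Ha Hb Hab. destruct (Rtotal_order a b) as [H|[H|H]]; [|contradiction|].
  - apply (gap_lt_mvt h h1 h2); auto.
  - rewrite gap_sym. apply (gap_lt_mvt h h1 h2); auto.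
Qed.

Definition phi (s a b : R) : R := gap (potential s) a b.

Lemma phi_pos (s a b : R) : 0 < a -> 0 < b -> a <> b -> 0 < phi s a b.
Proof.
  intros Ha Hb Hab.
  destruct (gap_mvt (potential s) (boxcox (s - 1)) (fun x => Rpower x (s - 1 - 1)) a b)
    as (c & k & Hc & Hk & E); auto.
  - apply is_derive_potential.
  - apply is_derive_boxcox.
  - unfold phi. rewrite E. apply Rmult_lt_0_compat; [apply Rpower_pos|exact Hk].
Qed.

(** The factor [(s - 1)/(s + 1)] is the quotient of the normalising constants [s (s - 1)] and
    [(s + 1) s] of the two potentials. The exceptional values of [s] are those at which [s] or
    [s + 1] meets a logarithmic potential. *)
Lemma lambda_ne_phi (s a b : R) :
  0 < a -> 0 < b -> a <> b -> lambda_ne s a b = phi (s + 1) a b / phi s a b.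
Proof.
  intros Ha Hb Hab.
  pose proof (phi_pos (s + 1) a b Ha Hb Hab) as P1.
  pose proof (phi_pos s a b Ha Hb Hab) as P0. revert P1 P0.
  assert (Hm : 0 < (a + b) / 2) by lra.
  unfold lambda_ne, phi, gap, potential, amean.
  destruct (Req_EM_T s (-1)) as [->|Hm1].
  { destruct (Req_EM_T (-1) 0); [lra|]. destruct (Req_EM_T (-1) 1); [lra|].
    destruct (Req_EM_T (-1 + 1) 0); [|lra].
    replace (-1) with (- (1)) by ring. rewrite !Rpower_Ropp, !Rpower_1 by lra.
    intros P1 P0. f_equal; field; lra. }
  destruct (Req_EM_T s 0) as [->|H0].
  { destruct (Req_EM_T (0 + 1) 0); [lra|]. destruct (Req_EM_T (0 + 1) 1); [|lra].
    intros P1 P0. f_equal; field. }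
  destruct (Req_EM_T s 1) as [->|H1].
  { destruct (Req_EM_T (1 + 1) 0); [lra|]. destruct (Req_EM_T (1 + 1) 1); [lra|].
    replace (1 + 1) with (INR 2) by (simpl; ring). rewrite !Rpower_pow by lra. simpl.
    intros P1 P0. field. lra. }
  destruct (Req_EM_T (s + 1) 0); [lra|]. destruct (Req_EM_T (s + 1) 1); [lra|].
  intros P1 P0.
  assert (E1 : forall X Y Z : R,
    (X / (s + 1) - a) / (s + 1 - 1) + (Y / (s + 1) - b) / (s + 1 - 1)
     - 2 * ((Z / (s + 1) - (a + b) / 2) / (s + 1 - 1)) = (X + Y - 2 * Z) / ((s + 1) * s)).
  { intros. field. lra. }
  assert (E0 : forall X Y Z : R,
    (X / s - a) / (s - 1) + (Y / s - b) / (s - 1)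
     - 2 * ((Z / s - (a + b) / 2) / (s - 1)) = (X + Y - 2 * Z) / (s * (s - 1))).
  { intros. field. lra. }
  rewrite E0 in P0. rewrite E0, E1. field. repeat split; try lra.
  intros E. rewrite E in P0. unfold Rdiv in P0. lra.
Qed.

(* Let [c = lambda_s]. The mean value theorem is applied to a function with second derivative
   [x^(s-2) (x - c) (x^(r-s) - c^(r-s)) >= 0], whose gap is [phi_(r+1) - c phi_r]
   since [phi_(s+1) = c phi_s]. *)
Lemma lambda_ne_mono (s r a b : R) :
  s <= r -> 0 < a -> 0 < b -> a <> b -> lambda_ne s a b <= lambda_ne r a b.
Proof.
  intros Hsr Ha Hb Hab. rewrite !lambda_ne_phi by assumption.
  pose proof (phi_pos (s + 1) a b Ha Hb Hab) as P1.
  pose proof (phi_pos s a b Ha Hb Hab) as P0.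
  pose proof (phi_pos r a b Ha Hb Hab) as Q0.
  set (c := phi (s + 1) a b / phi s a b).
  assert (Hc : 0 < c) by (apply Rdiv_lt_0_compat; assumption).
  set (e := Rpower c (r - s)).
  destruct (gap_mvt
    (fun x => (potential (r + 1) x - c * potential r x) - e * (potential (s + 1) x - c * potential s x))
    (fun x => (boxcox (r + 1 - 1) x - c * boxcox (r - 1) x)
       - e * (boxcox (s + 1 - 1) x - c * boxcox (s - 1) x))
    (fun x => (Rpower x (r + 1 - 1 - 1) - c * Rpower x (r - 1 - 1))
       - e * (Rpower x (s + 1 - 1 - 1) - c * Rpower x (s - 1 - 1))) a b)
    as (x & k & Hx & Hk & E); auto.
  { intros x Hx. repeat first [apply @is_derive_minus | apply is_derive_scal];
      apply is_derive_potential, Hx. }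
  { intros x Hx. repeat first [apply @is_derive_minus | apply is_derive_scal];
      apply is_derive_boxcox, Hx. }
  assert (F : gap (fun x => (potential (r + 1) x - c * potential r x)
      - e * (potential (s + 1) x - c * potential s x)) a b
      = phi (r + 1) a b - c * phi r a b - e * (phi (s + 1) a b - c * phi s a b)).
  { unfold phi, gap. ring. }
  rewrite F in E.
  replace (phi (s + 1) a b - c * phi s a b) with 0 in E by (unfold c; field; lra).
  apply Rmult_le_reg_r with (phi r a b); [exact Q0|].
  unfold Rdiv at 1. rewrite Rmult_assoc, Rinv_l by lra. rewrite Rmult_1_r.
  enough (0 <= phi (r + 1) a b - c * phi r a b) by lra.
  replace (phi (r + 1) a b - c * phi r a b) with
    (phi (r + 1) a b - c * phi r a b - e * 0) by ring.
  rewrite E. apply Rmult_le_pos; [|lra].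
  replace (Rpower x (r + 1 - 1 - 1)) with (Rpower x (s - 2) * x * Rpower x (r - s)).
  2: { rewrite <- (Rpower_1 x Hx) at 2. rewrite <- !Rpower_plus. f_equal. ring. }
  replace (Rpower x (r - 1 - 1)) with (Rpower x (s - 2) * Rpower x (r - s)).
  2: { rewrite <- !Rpower_plus. f_equal. ring. }
  replace (Rpower x (s + 1 - 1 - 1)) with (Rpower x (s - 2) * x).
  2: { rewrite <- (Rpower_1 x Hx) at 2. rewrite <- !Rpower_plus. f_equal. ring. }
  replace (s - 1 - 1) with (s - 2) by ring.
  replace (_ - _) with (Rpower x (s - 2) * ((x - c) * (Rpower x (r - s) - e))) by ring.
  apply Rmult_le_pos; [apply Rlt_le, Rpower_pos|].
  destruct (Rle_or_lt c x) as [H|H].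
  - apply Rmult_le_pos; [lra|]. apply Rge_le, Rge_minus, Rle_ge.
    unfold e. apply Rle_Rpower_l; lra.
  - rewrite <- Rmult_opp_opp. apply Rmult_le_pos; [lra|].
    assert (Rpower x (r - s) <= e) by (unfold e; apply Rle_Rpower_l; lra). lra.
Qed.

Lemma lambda_mono (s r a b : R) :
  s <= r -> 0 < a -> 0 < b -> lambda s a b <= lambda r a b.
Proof.
  intros. unfold lambda. destruct (Req_EM_T a b); [lra|]. apply lambda_ne_mono; assumption.
Qed.

(** * Homogeneity and the identric mean *)

Definition homogeneous_mean (M : R -> R -> R) : Prop :=
  (forall a, M a a = a) /\
  (forall a b, 0 < a -> 0 < b -> a <> b -> M a b = M b a) /\
  (forall k a b, 0 < k -> 0 < a -> 0 < b -> a <> b -> M (k * a) (k * b) = k * M a b).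

(** Dividing by the midpoint [k] turns a pair [a < b] into [1 - t], [1 + t], which leaves a
    comparison in the single variable [t]. *)
Lemma homogeneous_mean_le (M N : R -> R -> R) :
  homogeneous_mean M -> homogeneous_mean N ->
  (forall t, 0 < t < 1 -> M (1 - t) (1 + t) <= N (1 - t) (1 + t)) ->
  forall a b, 0 < a -> 0 < b -> M a b <= N a b.
Proof.
  intros (M1 & M2 & M3) (N1 & N2 & N3) H.
  assert (Hlt : forall a b, 0 < a -> a < b -> M a b <= N a b).
  { intros a b Ha Hab. set (k := (a + b) / 2). set (t := (b - a) / (a + b)).
    assert (Hk : 0 < k) by (unfold k; lra).
    assert (Ht : 0 < t < 1).
    { unfold t. split; [apply Rdiv_lt_0_compat; lra|].
      apply Rmult_lt_reg_r with (a + b); [lra|]. unfold Rdiv.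
      rewrite Rmult_assoc, Rinv_l by lra. lra. }
    replace a with (k * (1 - t)) by (unfold k, t; field; lra).
    replace b with (k * (1 + t)) by (unfold k, t; field; lra).
    rewrite M3, N3 by lra. apply Rmult_le_compat_l; [lra|]. apply H, Ht. }
  intros a b Ha Hb. destruct (Rtotal_order a b) as [L|[->|L]].
  - apply Hlt; assumption.
  - rewrite M1, N1. apply Rle_refl.
  - rewrite M2, N2 by lra. apply Hlt; assumption.
Qed.

(** Scaling the argument of a potential also produces constant and linear terms, from [ln k] and
    from the normalisation; the gap annihilates them. *)
Lemma phi_scale (s k a b : R) :
  0 < k -> 0 < a -> 0 < b -> phi s (k * a) (k * b) = Rpower k s * phi s a b.
Proof.
  intros Hk Ha Hb. unfold phi, gap.
  replace ((k * a + k * b) / 2) with (k * ((a + b) / 2)) by field.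
  assert (Hm : 0 < (a + b) / 2) by lra.
  unfold potential. destruct (Req_EM_T s 0) as [->|H0].
  - rewrite Rpower_O, !ln_mult by assumption. field.
  - destruct (Req_EM_T s 1) as [->|H1].
    + rewrite Rpower_1, !ln_mult by assumption. field.
    + rewrite <- !Rpower_mult_distr by assumption. field. lra.
Qed.

Lemma homogeneous_mean_lambda (s : R) : homogeneous_mean (lambda s).
Proof.
  split; [|split].
  - intros a. unfold lambda. destruct (Req_EM_T a a); [reflexivity|contradiction].
  - intros a b Ha Hb Hab. unfold lambda.
    destruct (Req_EM_T a b); [contradiction|]. destruct (Req_EM_T b a); [lra|].
    rewrite !lambda_ne_phi by auto. unfold phi. rewrite !(gap_sym _ b a). reflexivity.
  - intros k a b Hk Ha Hb Hab. unfold lambda.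
    assert (k * a <> k * b) by (intros E; apply Rmult_eq_reg_l in E; lra).
    destruct (Req_EM_T a b); [contradiction|].
    destruct (Req_EM_T (k * a) (k * b)); [contradiction|].
    rewrite !lambda_ne_phi by (try apply Rmult_lt_0_compat; auto).
    rewrite !phi_scale by assumption. rewrite Rpower_plus, Rpower_1 by assumption.
    pose proof (phi_pos s a b Ha Hb ltac:(assumption)). pose proof (Rpower_pos k s).
    field. repeat split; lra.
Qed.

Lemma ln_neq (a b : R) : 0 < a -> 0 < b -> a <> b -> ln b - ln a <> 0.
Proof. intros Ha Hb Hab E. apply Hab, ln_inv; lra. Qed.

Lemma homogeneous_mean_logmean : homogeneous_mean logmean.
Proof.
  split; [|split].
  - intros a. unfold logmean. destruct (Req_EM_T a a); [reflexivity|contradiction].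
  - intros a b Ha Hb Hab. unfold logmean.
    destruct (Req_EM_T a b); [contradiction|]. destruct (Req_EM_T b a); [lra|].
    field. repeat split; apply ln_neq; auto.
  - intros k a b Hk Ha Hb Hab. unfold logmean.
    assert (k * a <> k * b) by (intros E; apply Rmult_eq_reg_l in E; lra).
    destruct (Req_EM_T a b); [contradiction|].
    destruct (Req_EM_T (k * a) (k * b)); [contradiction|].
    rewrite !ln_mult by assumption. pose proof (ln_neq a b Ha Hb Hab).
    field. assumption.
Qed.

Lemma identric_exp (a b : R) :
  0 < a -> 0 < b -> a <> b ->
  identric a b = exp ((b * ln b - a * ln a) / (b - a) - 1).
Proof.
  intros Ha Hb Hab. unfold identric. destruct (Req_EM_T a b); [contradiction|].
  replace ((b * ln b - a * ln a) / (b - a) - 1)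
    with (- (1) + / (b - a) * (b * ln b - a * ln a)) by (field; lra).
  rewrite exp_plus, exp_Ropp. f_equal. unfold Rpower at 1. f_equal. f_equal.
  rewrite ln_div by apply Rpower_pos. unfold Rpower. rewrite !ln_exp. reflexivity.
Qed.

Lemma homogeneous_mean_identric : homogeneous_mean identric.
Proof.
  split; [|split].
  - intros a. unfold identric. destruct (Req_EM_T a a); [reflexivity|contradiction].
  - intros a b Ha Hb Hab. rewrite !identric_exp by auto. f_equal. field. split; lra.
  - intros k a b Hk Ha Hb Hab.
    assert (k * a <> k * b) by (intros E; apply Rmult_eq_reg_l in E; lra).
    rewrite !identric_exp by (try apply Rmult_lt_0_compat; auto).
    rewrite !ln_mult by assumption.
    replace ((k * b * (ln k + ln b) - k * a * (ln k + ln a)) / (k * b - k * a) - 1)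
      with (ln k + ((b * ln b - a * ln a) / (b - a) - 1)).
    { rewrite exp_plus, exp_ln by exact Hk. reflexivity. }
    field. split; [|lra]. intros E. apply Hab, Rmult_eq_reg_l with k; lra.
Qed.

Lemma nondecreasing_of_derive (f f' : R -> R) (a b : R) :
  a <= b ->
  (forall x, a <= x <= b -> is_derive f x (f' x)) ->
  (forall x, a < x < b -> 0 <= f' x) -> f a <= f b.
Proof.
  intros [Hab| ->] D P; [|apply Rle_refl].
  destruct (MVT_cor2 f f' a b Hab) as (c & E & I).
  { intros x Hx. apply is_derive_Reals, D, Hx. }
  pose proof (P c I). pose proof (Rmult_le_pos (f' c) (b - a)). lra.
Qed.

(* Replaces the boundary value at [0] for functions with a removable singularity there. *)
Lemma nonneg_of_derive_pos (f f' : R -> R) (t : R) :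
  0 < t ->
  (forall x, 0 < x <= t -> is_derive f x (f' x)) ->
  (forall x, 0 < x < t -> 0 <= f' x) ->
  (forall x, 0 < x <= t -> - 2 * x <= f x) -> 0 <= f t.
Proof.
  intros Ht D P B. destruct (Rle_or_lt 0 (f t)) as [|N]; [assumption|].
  set (x := Rmin t (- f t / 4)).
  assert (Hx : 0 < x <= t).
  { split; [apply Rmin_glb_lt; lra|apply Rmin_l]. }
  assert (Hx2 : x <= - f t / 4) by apply Rmin_r.
  assert (f x <= f t).
  { apply nondecreasing_of_derive with f'; [lra| |].
    - intros y Hy. apply D. lra.
    - intros y Hy. apply P. lra. }
  pose proof (B x Hx). lra.
Qed.

(** * Estimates for the logarithms of 1 + t and 1 - t *)

Lemma ln_le_sub1 (x : R) : 0 < x -> ln x <= x - 1.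
Proof. intros Hx. pose proof (exp_ineq1_le (ln x)) as H. rewrite exp_ln in H by exact Hx. lra. Qed.

Lemma ln_ge_1_sub_inv (x : R) : 0 < x -> 1 - / x <= ln x.
Proof.
  intros Hx. pose proof (ln_le_sub1 (/ x) (Rinv_0_lt_compat x Hx)) as H.
  rewrite ln_Rinv in H by exact Hx. lra.
Qed.

(** At the pair [1 - t], [1 + t] these three functions encode the means: [log_ratio t = 2 t / L],
    [xlnx_sum t = t^2 / lambda_1] and [xlnx_diff t = 2 t (1 + ln I)]. *)
Definition log_ratio (t : R) : R := ln (1 + t) - ln (1 - t).
Definition xlnx_sum (t : R) : R := (1 - t) * ln (1 - t) + (1 + t) * ln (1 + t).
Definition xlnx_diff (t : R) : R := (1 + t) * ln (1 + t) - (1 - t) * ln (1 - t).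

Lemma is_derive_log_ratio (t : R) : -1 < t < 1 -> is_derive log_ratio t (2 / (1 - t ^ 2)).
Proof.
  intros Ht. unfold log_ratio. auto_derive; [lra|]. field.
  split; [|split]; try lra. nra.
Qed.

Lemma is_derive_xlnx_sum (t : R) : -1 < t < 1 -> is_derive xlnx_sum t (log_ratio t).
Proof. intros Ht. unfold xlnx_sum, log_ratio. auto_derive; [lra|].
  change (1 + - t) with (1 - t). field. lra. Qed.

Lemma is_derive_xlnx_diff (t : R) : -1 < t < 1 -> is_derive xlnx_diff t (2 + ln (1 + t) + ln (1 - t)).
Proof. intros Ht. unfold xlnx_diff. auto_derive; [lra|].
  change (1 + - t) with (1 - t). field. lra. Qed.

Lemma log_ratio_xlnx_0 : log_ratio 0 = 0 /\ xlnx_sum 0 = 0 /\ xlnx_diff 0 = 0.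
Proof.
  unfold log_ratio, xlnx_sum, xlnx_diff. rewrite Rplus_0_r, Rminus_0_r, ln_1. repeat split; ring.
Qed.

Lemma log_ratio_ge (t : R) : 0 <= t < 1 -> 2 * t <= log_ratio t.
Proof.
  intros Ht.
  assert (log_ratio 0 - 2 * 0 <= log_ratio t - 2 * t).
  { apply (nondecreasing_of_derive (fun x => log_ratio x - 2 * x) (fun x => 2 / (1 - x ^ 2) - 2)); [lra| |].
    - intros x Hx. apply @is_derive_minus; [apply is_derive_log_ratio; lra|]. auto_derive; [trivial|ring].
    - intros x Hx. replace (2 / (1 - x ^ 2) - 2) with (2 * x ^ 2 / (1 - x ^ 2)) by (field; nra).
      apply Rdiv_le_0_compat; nra. }
  destruct log_ratio_xlnx_0 as (E & _). lra.
Qed.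

Lemma xlnx_sum_ge (t : R) : 0 <= t < 1 -> t ^ 2 <= xlnx_sum t.
Proof.
  intros Ht.
  assert (xlnx_sum 0 - 0 ^ 2 <= xlnx_sum t - t ^ 2).
  { apply (nondecreasing_of_derive (fun x => xlnx_sum x - x ^ 2) (fun x => log_ratio x - 2 * x)); [lra| |].
    - intros x Hx. apply @is_derive_minus; [apply is_derive_xlnx_sum; lra|]. auto_derive; [trivial|ring].
    - intros x Hx. pose proof (log_ratio_ge x). lra. }
  destruct log_ratio_xlnx_0 as (_ & E & _). lra.
Qed.

Lemma xlnx_sum_le (t : R) : 0 <= t < 1 -> xlnx_sum t <= 2 * t ^ 2.
Proof.
  intros Ht. unfold xlnx_sum.
  pose proof (ln_le_sub1 (1 + t)). pose proof (ln_le_sub1 (1 - t)). nra.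
Qed.

Lemma xlnx_diff_le (t : R) : 0 <= t < 1 -> xlnx_diff t <= 2 * t - t ^ 3 / 3.
Proof.
  intros Ht.
  assert (2 * 0 - 0 ^ 3 / 3 - xlnx_diff 0 <= 2 * t - t ^ 3 / 3 - xlnx_diff t).
  { apply (nondecreasing_of_derive (fun x => 2 * x - x ^ 3 / 3 - xlnx_diff x)
      (fun x => 2 - x ^ 2 - (2 + ln (1 + x) + ln (1 - x)))); [lra| |].
    - intros x Hx. apply @is_derive_minus; [|apply is_derive_xlnx_diff; lra].
      auto_derive; [trivial|field].
    - intros x Hx. pose proof (ln_le_sub1 ((1 + x) * (1 - x))) as H.
      rewrite ln_mult in H by lra. nra. }
  destruct log_ratio_xlnx_0 as (_ & _ & E). lra.
Qed.

Lemma xlnx_diff_ge (t : R) : 0 <= t < 1 -> 2 * t - t ^ 2 <= xlnx_diff t.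
Proof.
  intros Ht. unfold xlnx_diff.
  pose proof (ln_ge_1_sub_inv (1 + t) ltac:(lra)) as H.
  pose proof (ln_le_sub1 (1 - t) ltac:(lra)).
  apply (Rmult_le_compat_l (1 + t)) in H; [|lra].
  rewrite Rmult_minus_distr_l, Rinv_r in H by lra. nra.
Qed.

(* [L >= G^(2/3) A^(1/3)], where [w] below is the cube root of [1 - t^2]. *)
Lemma log_ratio_cube_le (t : R) : 0 <= t < 1 -> log_ratio t ^ 3 <= 8 * t ^ 3 / (1 - t ^ 2).
Proof.
  intros Ht.
  set (w := fun x => exp (/ 3 * ln (1 - x ^ 2))).
  assert (Hw : forall x, 0 <= x < 1 -> 0 < w x /\ w x ^ 3 = 1 - x ^ 2).
  { intros x Hx. split; [apply exp_pos|]. unfold w.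
    replace (exp (/ 3 * ln (1 - x ^ 2)) ^ 3) with (Rpower (exp (/ 3 * ln (1 - x ^ 2))) (INR 3)).
    2: { apply Rpower_pow, exp_pos. }
    unfold Rpower. rewrite ln_exp. replace (INR 3 * (/ 3 * ln (1 - x ^ 2))) with (ln (1 - x ^ 2)).
    - apply exp_ln. nra.
    - simpl INR. field. }
  assert (2 * 0 / w 0 - log_ratio 0 <= 2 * t / w t - log_ratio t).
  { apply (nondecreasing_of_derive (fun x => 2 * x / w x - log_ratio x)
      (fun x => 2 / w x + 4 / 3 * x ^ 2 / (w x * (1 - x ^ 2)) - 2 / (1 - x ^ 2))); [lra| |].
    - intros x Hx. apply @is_derive_minus; [|apply is_derive_log_ratio; lra].
      assert (0 < 1 - x ^ 2) by nra.
      assert (1 - x * x <> 0) by nra. destruct (Hw x) as [Hp _]; [lra|]. unfold w in *. simpl in *.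
      auto_derive.
      + repeat split; try lra. apply Rgt_not_eq, exp_pos.
      + change (1 + - (x * (x * 1))) with (1 - x * (x * 1)). field. repeat split; lra.
    - intros x Hx. destruct (Hw x) as [Hp E]; [lra|]. rewrite <- E.
      replace (2 / w x + 4 / 3 * x ^ 2 / (w x * w x ^ 3) - 2 / w x ^ 3)
        with (2 / w x ^ 4 * (w x ^ 3 + 2 / 3 * x ^ 2 - w x)) by (field; lra).
      assert (x ^ 2 = 1 - w x ^ 3) by lra.
      apply Rmult_le_pos.
      + apply Rlt_le, Rdiv_lt_0_compat; [lra|]. apply pow_lt, Hp.
      (* Substituting [x^2 = 1 - w^3] turns the bracket into [(w^3 - 3 w + 2) / 3], and the cubic
         has the double root 1. *)
      + assert (0 <= (w x - 1) ^ 2 * (w x + 2)) by (apply Rmult_le_pos; [apply pow2_ge_0|lra]).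
        nra. }
  destruct log_ratio_xlnx_0 as (E0 & _). rewrite E0 in H.
  assert (L : log_ratio t <= 2 * t / w t) by lra.
  destruct (Hw t Ht) as [Hp E]. rewrite <- E.
  replace (8 * t ^ 3 / w t ^ 3) with ((2 * t / w t) ^ 3) by (field; lra).
  apply pow_incr. split; [|exact L]. pose proof (log_ratio_ge t Ht). lra.
Qed.

(** In terms of means this is [(A + L) / 2 <= lambda_1] with arithmetic mean [A = 1]. After division
    by [log_ratio t + 2 t] almost everything cancels in the derivative of the difference, and the
    numerator left over is the difference of the two sides of [log_ratio_cube_le]. *)
Lemma xlnx_sum_log_ratio_le (t : R) : 0 < t < 1 -> xlnx_sum t * (log_ratio t + 2 * t) <= 2 * t ^ 2 * log_ratio t.
Proof.
  intros Ht.
  assert (H : 0 <= 2 * t ^ 2 * log_ratio t / (log_ratio t + 2 * t) - xlnx_sum t).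
  { apply (nonneg_of_derive_pos (fun x => 2 * x ^ 2 * log_ratio x / (log_ratio x + 2 * x) - xlnx_sum x)
      (fun x => (8 * x ^ 3 / (1 - x ^ 2) - log_ratio x ^ 3) / (log_ratio x + 2 * x) ^ 2)); [lra| | |].
    - intros x Hx. pose proof (log_ratio_ge x ltac:(lra)).
      pose proof (is_derive_log_ratio x ltac:(lra)) as D.
      assert (Ex : ex_derive log_ratio x) by (eexists; exact D).
      apply is_derive_unique in D. evar_last.
      + apply @is_derive_minus; [|apply is_derive_xlnx_sum; lra].
        auto_derive; [repeat split; auto; lra|reflexivity].
      + assert (1 - x ^ 2 <> 0) by nra. change (Derive (fun x => log_ratio x) x) with (Derive log_ratio x).
        rewrite D. unfold minus, plus, opp; simpl. field. split; [lra|simpl in *; lra].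
    - intros x Hx. pose proof (log_ratio_ge x ltac:(lra)). pose proof (log_ratio_cube_le x ltac:(lra)).
      apply Rdiv_le_0_compat; [lra|]. apply pow_lt. lra.
    - intros x Hx. pose proof (log_ratio_ge x ltac:(lra)). pose proof (xlnx_sum_le x ltac:(lra)).
      assert (0 <= 2 * x ^ 2 * log_ratio x / (log_ratio x + 2 * x)).
      { apply Rdiv_le_0_compat; [|lra]. apply Rmult_le_pos; nra. }
      nra. }
  pose proof (log_ratio_ge t ltac:(lra)).
  apply (Rmult_le_compat_r (log_ratio t + 2 * t)) in H; [|lra].
  replace ((2 * t ^ 2 * log_ratio t / (log_ratio t + 2 * t) - xlnx_sum t) * (log_ratio t + 2 * t))
    with (2 * t ^ 2 * log_ratio t - xlnx_sum t * (log_ratio t + 2 * t)) in H by (field; lra).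
  lra.
Qed.

(** The expression is [ln (I / lambda_1)]. Differentiating the logarithm removes the exponential
    from the identric mean, and the sign of the derivative is [xlnx_sum_log_ratio_le]. *)
Lemma ln_xlnx_sum_ge (t : R) : 0 < t < 1 -> 0 <= ln (xlnx_sum t) - 2 * ln t - (1 - xlnx_diff t / (2 * t)).
Proof.
  intros Ht.
  apply (nonneg_of_derive_pos (fun t => ln (xlnx_sum t) - 2 * ln t - (1 - xlnx_diff t / (2 * t)))
    (fun x => (2 * x ^ 2 * log_ratio x - xlnx_sum x * (log_ratio x + 2 * x)) / (2 * x ^ 2 * xlnx_sum x))); [lra| | |].
  - intros x Hx. pose proof (xlnx_sum_ge x ltac:(lra)). assert (0 < xlnx_sum x) by (pose proof (pow_lt x 2 ltac:(lra)); lra).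
    pose proof (is_derive_xlnx_sum x ltac:(lra)) as D.
    assert (Ex : ex_derive xlnx_sum x) by (eexists; exact D).
    apply is_derive_unique in D.
    pose proof (is_derive_xlnx_diff x ltac:(lra)) as D'.
    assert (Ex' : ex_derive xlnx_diff x) by (eexists; exact D').
    apply is_derive_unique in D'. auto_derive.
    + repeat split; auto; lra.
    + change (Derive (fun x => xlnx_sum x) x) with (Derive xlnx_sum x).
      change (Derive (fun x => xlnx_diff x) x) with (Derive xlnx_diff x).
      rewrite D, D'. unfold xlnx_diff, log_ratio. field. split; lra.
  - intros x Hx. pose proof (xlnx_sum_ge x ltac:(lra)). assert (0 < xlnx_sum x) by (pose proof (pow_lt x 2 ltac:(lra)); lra).
    pose proof (xlnx_sum_log_ratio_le x ltac:(lra)). apply Rdiv_le_0_compat; [lra|].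
    pose proof (pow_lt x 2 ltac:(lra)). apply Rmult_lt_0_compat; lra.
  - intros x Hx. pose proof (xlnx_sum_ge x ltac:(lra)).
    assert (ln (x ^ 2) <= ln (xlnx_sum x)) by (apply ln_le; nra).
    assert (E : ln (x ^ 2) = 2 * ln x) by (rewrite ln_pow by lra; simpl; ring).
    pose proof (xlnx_diff_ge x ltac:(lra)).
    assert (1 - x / 2 <= xlnx_diff x / (2 * x)).
    { apply Rmult_le_reg_r with (2 * x); [lra|].
      replace (xlnx_diff x / (2 * x) * (2 * x)) with (xlnx_diff x) by (field; lra). nra. }
    lra.
Qed.

Lemma identric_unit (t : R) :
  0 < t < 1 -> identric (1 - t) (1 + t) = exp (xlnx_diff t / (2 * t) - 1).
Proof.
  intros Ht. rewrite identric_exp by lra. unfold xlnx_diff. f_equal. f_equal. f_equal. ring.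
Qed.

Lemma lambda_1_le_identric (a b : R) : 0 < a -> 0 < b -> lambda 1 a b <= identric a b.
Proof.
  revert a b. apply homogeneous_mean_le.
  - apply homogeneous_mean_lambda.
  - apply homogeneous_mean_identric.
  - intros t Ht. rewrite identric_unit by exact Ht. unfold lambda, lambda_ne, amean.
    destruct (Req_EM_T (1 - t) (1 + t)); [lra|].
    destruct (Req_EM_T 1 (-1)); [lra|]. destruct (Req_EM_T 1 0); [lra|].
    destruct (Req_EM_T 1 1); [|lra].
    replace ((1 - t + (1 + t)) / 2) with 1 by field. rewrite ln_1, Rmult_0_r, Rminus_0_r.
    fold (xlnx_sum t). pose proof (xlnx_sum_ge t ltac:(lra)). assert (0 < xlnx_sum t) by (pose proof (pow_lt t 2 ltac:(lra)); lra).
    assert (0 < t ^ 2) by nra.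
    replace ((1 + t - (1 - t)) ^ 2 / (4 * xlnx_sum t)) with (t ^ 2 / xlnx_sum t) by (field; lra).
    rewrite <- (exp_ln (t ^ 2 / xlnx_sum t)) by (apply Rdiv_lt_0_compat; lra).
    pose proof (ln_xlnx_sum_ge t Ht).
    assert (D : ln (t ^ 2 / xlnx_sum t) <= xlnx_diff t / (2 * t) - 1).
    { rewrite ln_div, ln_pow by lra. simpl INR. lra. }
    destruct D as [D|D]; [apply Rlt_le, exp_increasing, D|rewrite D; apply Rle_refl].
Qed.

(** * Failure of the upper bound for parameters above 1 *)

Lemma is_derive_flip (f : R -> R) (t l : R) :
  is_derive f (1 - t) l -> is_derive (fun x => f (1 - x)) t (- l).
Proof.
  intros D. evar_last.
  - apply (is_derive_comp f (fun x => 1 - x)); [exact D|].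
    auto_derive; [trivial|reflexivity].
  - unfold scal; simpl; unfold mult; simpl. ring.
Qed.

Lemma is_derive_shift (f : R -> R) (t l : R) :
  is_derive f (1 + t) l -> is_derive (fun x => f (1 + x)) t l.
Proof.
  intros D. evar_last.
  - apply (is_derive_comp f (fun x => 1 + x)); [exact D|].
    auto_derive; [trivial|reflexivity].
  - unfold scal; simpl; unfold mult; simpl. ring.
Qed.

Lemma is_derive_phi_unit (s t : R) :
  0 <= t < 1 ->
  is_derive (fun t => phi s (1 - t) (1 + t)) t (boxcox (s - 1) (1 + t) - boxcox (s - 1) (1 - t)).
Proof.
  intros Ht. apply is_derive_ext with
    (fun t => potential s (1 - t) + potential s (1 + t) - 2 * potential s 1).
  { intros x. unfold phi, gap. do 3 f_equal. simpl. field. }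
  evar_last.
  - apply @is_derive_minus; [|apply @is_derive_const]. apply @is_derive_plus.
    + apply is_derive_flip, is_derive_potential. lra.
    + apply is_derive_shift, is_derive_potential. lra.
  - unfold minus, plus, opp, zero; simpl. ring.
Qed.

Lemma is_derive_phi_unit2 (s t : R) :
  0 <= t < 1 ->
  is_derive (fun t => boxcox (s - 1) (1 + t) - boxcox (s - 1) (1 - t)) t
    (Rpower (1 + t) (s - 2) + Rpower (1 - t) (s - 2)).
Proof.
  intros Ht. evar_last.
  - apply @is_derive_minus.
    + apply is_derive_shift, is_derive_boxcox. lra.
    + apply is_derive_flip, is_derive_boxcox. lra.
  - unfold minus, plus, opp; simpl. replace (s - 1 - 1) with (s - 2) by ring. ring.
Qed.

Lemma phi_unit_0 (s : R) : phi s (1 - 0) (1 + 0) = 0.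
Proof.
  unfold phi, gap. rewrite Rminus_0_r, Rplus_0_r. replace ((1 + 1) / 2) with 1 by field. ring.
Qed.

(** For [0 < s - 1 < 1] the second derivative in [t] is at least [1 + (1 - t)]; two integrations
    from 0 give the bound. This crude form suffices because it is used only after multiplication by
    [t^2]. *)
Lemma phi_unit_ge (s t : R) :
  1 < s < 2 -> 0 <= t < 1 -> t ^ 2 - t ^ 3 / 6 <= phi (s + 1) (1 - t) (1 + t).
Proof.
  intros Hs Ht.
  set (d := fun x => boxcox (s + 1 - 1) (1 + x) - boxcox (s + 1 - 1) (1 - x)).
  assert (H1 : forall x, 0 <= x < 1 -> 2 * x - x ^ 2 / 2 <= d x).
  { intros x Hx.
    assert (d 0 - (2 * 0 - 0 ^ 2 / 2) <= d x - (2 * x - x ^ 2 / 2)).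
    { apply (nondecreasing_of_derive (fun x => d x - (2 * x - x ^ 2 / 2))
        (fun x => (Rpower (1 + x) (s + 1 - 2) + Rpower (1 - x) (s + 1 - 2)) - (2 - x))); [lra| |].
      - intros y Hy. apply @is_derive_minus; [apply is_derive_phi_unit2; lra|].
        auto_derive; [trivial|field].
      - intros y Hy.
        assert (1 <= Rpower (1 + y) (s + 1 - 2)).
        { rewrite <- (Rpower_O (1 + y) ltac:(lra)) at 1. apply Rle_Rpower; lra. }
        assert (1 - y <= Rpower (1 - y) (s + 1 - 2)).
        { rewrite <- (Rpower_1 (1 - y)) at 1 by lra. unfold Rpower.
          assert (ln (1 - y) < 0) by (rewrite <- ln_1; apply ln_increasing; lra).
          destruct (Rle_lt_or_eq_dec (1 * ln (1 - y)) ((s + 1 - 2) * ln (1 - y))) as [H2|H2].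
          - nra.
          - apply Rlt_le, exp_increasing, H2.
          - rewrite H2. apply Rle_refl. }
        lra. }
    assert (d 0 = 0) by (unfold d; rewrite Rplus_0_r, Rminus_0_r; ring). lra. }
  assert (phi (s + 1) (1 - 0) (1 + 0) - (0 ^ 2 - 0 ^ 3 / 6)
    <= phi (s + 1) (1 - t) (1 + t) - (t ^ 2 - t ^ 3 / 6)).
  { apply (nondecreasing_of_derive (fun t => phi (s + 1) (1 - t) (1 + t) - (t ^ 2 - t ^ 3 / 6))
      (fun x => d x - (2 * x - x ^ 2 / 2))); [lra| |].
    - intros x Hx. apply @is_derive_minus; [apply is_derive_phi_unit; lra|].
      auto_derive; [trivial|field].
    - intros x Hx. pose proof (H1 x ltac:(lra)). lra. }
  rewrite phi_unit_0 in H. lra.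
Qed.

Lemma pos_near_of_derive (f : R -> R) (l : R) :
  f 0 = 0 -> is_derive f 0 l -> 0 < l ->
  exists d, 0 < d /\ forall x, 0 < x < d -> 0 < f x.
Proof.
  intros E D Hl. apply is_derive_Reals in D. destruct (D l Hl) as [d Hd].
  exists d. split; [apply cond_pos|]. intros x Hx.
  assert (A : Rabs ((f (0 + x) - f 0) / x - l) < l).
  { apply Hd; [lra|]. rewrite Rabs_pos_eq; lra. }
  rewrite Rplus_0_l, E, Rminus_0_r in A. apply Rabs_def2 in A.
  replace (f x) with (f x / x * x) by (field; lra). apply Rmult_lt_0_compat; lra.
Qed.

(* [phi_(s+1) - phi_s] is [(s - 2) t^4 / 6] to leading order. *)
Lemma phi_unit_diff (s k : R) :
  2 - s < k -> exists d, 0 < d /\ forall t, 0 < t < d -> t < 1 ->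
    0 <= 6 * (phi (s + 1) (1 - t) (1 + t) - phi s (1 - t) (1 + t)) + k * t ^ 4.
Proof.
  intros Hk.
  (* The second derivative of the target is [6 t] times this function, since [(1 + t)^(s-1) - (1 +
     t)^(s-2) = t (1 + t)^(s-2)], and likewise with [- t]. Its slope [2 k + 2 (s - 2)] at 0 is
     positive by hypothesis. *)
  destruct (pos_near_of_derive
    (fun t => 2 * k * t + (Rpower (1 + t) (s - 2) - Rpower (1 - t) (s - 2))) (2 * k + 2 * (s - 2)))
    as (d & Hd & P).
  - rewrite Rplus_0_r, Rminus_0_r. ring.
  - evar_last.
    + apply @is_derive_plus; [apply is_derive_scal, @is_derive_id|].
      apply @is_derive_minus.
      * apply (is_derive_shift (fun x => Rpower x (s - 2))), is_derive_Rpower_base. lra.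
      * apply (is_derive_flip (fun x => Rpower x (s - 2))), is_derive_Rpower_base. lra.
    + unfold minus, plus, opp, one; simpl. rewrite Rplus_0_r, Rminus_0_r.
      assert (E : Rpower 1 (s - 2 - 1) = 1) by (unfold Rpower; rewrite ln_1, Rmult_0_r; apply exp_0).
      rewrite E. ring.
  - lra.
  - exists d. split; [exact Hd|].
    set (e := fun s x => boxcox (s - 1) (1 + x) - boxcox (s - 1) (1 - x)).
    assert (H1 : forall t, 0 <= t < d -> t < 1 -> 0 <= 6 * (e (s + 1) t - e s t) + 4 * k * t ^ 3).
    { intros t Ht Ht1.
      assert (6 * (e (s + 1) 0 - e s 0) + 4 * k * 0 ^ 3 <= 6 * (e (s + 1) t - e s t) + 4 * k * t ^ 3).
      { apply (nondecreasing_of_derive (fun t => 6 * (e (s + 1) t - e s t) + 4 * k * t ^ 3)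
          (fun t => 6 * ((Rpower (1 + t) (s + 1 - 2) + Rpower (1 - t) (s + 1 - 2))
            - (Rpower (1 + t) (s - 2) + Rpower (1 - t) (s - 2))) + 12 * k * t ^ 2)); [lra| |].
        - intros x Hx. apply @is_derive_plus.
          + apply is_derive_scal. apply @is_derive_minus; apply is_derive_phi_unit2; lra.
          + auto_derive; [trivial|ring].
        - intros x Hx. replace (s + 1 - 2) with (s - 2 + 1) by ring.
          rewrite !Rpower_plus, !Rpower_1 by lra. pose proof (P x ltac:(lra)) as Px.
          match goal with |- 0 <= ?g => replace g with (6 * x * (2 * k * x
            + (Rpower (1 + x) (s - 2) - Rpower (1 - x) (s - 2)))) by ring end.
          apply Rmult_le_pos; lra. }
      assert (forall s, e s 0 = 0) as E0.
      { intros r. unfold e. rewrite Rplus_0_r, Rminus_0_r. ring. }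
      rewrite !E0 in H. lra. }
    intros t Ht Ht1.
    assert (6 * (phi (s + 1) (1 - 0) (1 + 0) - phi s (1 - 0) (1 + 0)) + k * 0 ^ 4
      <= 6 * (phi (s + 1) (1 - t) (1 + t) - phi s (1 - t) (1 + t)) + k * t ^ 4).
    { apply (nondecreasing_of_derive
        (fun t => 6 * (phi (s + 1) (1 - t) (1 + t) - phi s (1 - t) (1 + t)) + k * t ^ 4)
        (fun t => 6 * (e (s + 1) t - e s t) + 4 * k * t ^ 3)); [lra| |].
      - intros x Hx. apply @is_derive_plus.
        + apply is_derive_scal. apply @is_derive_minus; apply is_derive_phi_unit; lra.
        + auto_derive; [trivial|ring].
      - intros x Hx. apply H1; lra. }
    rewrite !phi_unit_0 in H. lra.
Qed.

(** The bound passes through [exp (- t^2/6)]. It keeps the exact second-order term of [I] and is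
    rational, so the comparison with [phi] stays polynomial. *)
Lemma identric_unit_le (t : R) : 0 < t < 1 -> identric (1 - t) (1 + t) <= 6 / (6 + t ^ 2).
Proof.
  intros Ht. rewrite identric_unit by exact Ht.
  pose proof (xlnx_diff_le t ltac:(lra)).
  assert (E : xlnx_diff t / (2 * t) - 1 <= - (t ^ 2 / 6)).
  { apply Rmult_le_reg_r with (2 * t); [lra|].
    replace ((xlnx_diff t / (2 * t) - 1) * (2 * t)) with (xlnx_diff t - 2 * t) by (field; lra). nra. }
  assert (0 < t ^ 2) by nra.
  apply Rle_trans with (exp (- (t ^ 2 / 6))).
  - destruct E as [E|E]; [apply Rlt_le, exp_increasing, E|rewrite E; apply Rle_refl].
  - rewrite exp_Ropp. replace (6 / (6 + t ^ 2)) with (/ (1 + t ^ 2 / 6)) by (field; lra).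
    apply Rinv_le_contravar; [lra|]. pose proof (exp_ineq1_le (t ^ 2 / 6)). lra.
Qed.

Lemma le_1_of_lambda_le_identric (s : R) :
  (forall a b, 0 < a -> 0 < b -> lambda s a b <= identric a b) -> s <= 1.
Proof.
  intros H. destruct (Rle_or_lt s 1) as [|Hs]; [assumption|exfalso].
  (* By monotonicity a failure at [r <= s] suffices, and [r < 2] is the range of [phi_unit_ge]. *)
  set (r := Rmin s (3 / 2)).
  assert (Hr : 1 < r < 2).
  { split; [apply Rmin_glb_lt; lra|]. pose proof (Rmin_r s (3 / 2)). unfold r. lra. }
  (* The constant is the midpoint of [2 - r] and 1. It must exceed [2 - r] here and stay below 1 to
     contradict [t^2 u <= 6 (v - u)]; the margin [(r - 1)/2] absorbs the cubic error because
     [t < r - 1]. *)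
  destruct (phi_unit_diff r ((3 - r) / 2) ltac:(lra)) as (d & Hd & P).
  set (t := Rmin d (r - 1) / 2).
  assert (Ht : 0 < t /\ t < d /\ t < r - 1).
  { pose proof (Rmin_l d (r - 1)). pose proof (Rmin_r d (r - 1)).
    assert (0 < Rmin d (r - 1)) by (apply Rmin_glb_lt; lra). unfold t. lra. }
  specialize (P t ltac:(lra) ltac:(lra)).
  pose proof (phi_unit_ge r t Hr ltac:(lra)) as G.
  pose proof (phi_pos r (1 - t) (1 + t) ltac:(lra) ltac:(lra) ltac:(lra)) as P0.
  pose proof (H (1 - t) (1 + t) ltac:(lra) ltac:(lra)) as HI.
  pose proof (lambda_mono r s (1 - t) (1 + t) (Rmin_l _ _) ltac:(lra) ltac:(lra)) as HM.
  pose proof (identric_unit_le t ltac:(lra)) as HJ.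
  assert (HL : phi (r + 1) (1 - t) (1 + t) / phi r (1 - t) (1 + t) <= 6 / (6 + t ^ 2)).
  { rewrite <- lambda_ne_phi by lra. unfold lambda at 1 in HM.
    destruct (Req_EM_T (1 - t) (1 + t)); lra. }
  assert (T2 : 0 < t ^ 2) by nra.
  set (u := phi (r + 1) (1 - t) (1 + t)) in *. set (v := phi r (1 - t) (1 + t)) in *.
  apply (Rmult_le_compat_r (v * (6 + t ^ 2))) in HL; [|apply Rmult_le_pos; lra].
  replace (u / v * (v * (6 + t ^ 2))) with (u * (6 + t ^ 2)) in HL by (field; lra).
  replace (6 / (6 + t ^ 2) * (v * (6 + t ^ 2))) with (6 * v) in HL by (field; lra).
  assert ((3 - r) / 2 * t ^ 4 < t ^ 2 * u).
  { replace ((3 - r) / 2 * t ^ 4) with (t ^ 2 * ((3 - r) / 2 * t ^ 2)) by ring.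
    apply Rmult_lt_compat_l; [lra|]. nra. }
  lra.
Qed.

(** * The lower bound as a positivity statement for power series *)

Lemma CV_radius_of_bounded (a : nat -> R) (M x : R) :
  (forall n, Rabs (a n) <= M) -> Rabs x < 1 -> Rbar_lt (Rabs x) (CV_radius a).
Proof.
  intros H Hx. apply Rbar_lt_le_trans with 1; [exact Hx|].
  apply (proj1 (CV_radius_bounded a)). exists M. intros n.
  rewrite pow1, Rmult_1_r. apply H.
Qed.

(** * The binomial series and the coefficients of both sides *)

Fixpoint gbinom (s : R) (n : nat) : R :=
  match n with
  | O => 1
  | S m => gbinom s m * ((s - INR m) / INR (S m))
  end.

Lemma gbinom_bounded (s : R) (n : nat) : 0 <= s <= 2 -> Rabs (gbinom s n) <= 2.
Proof.
  intros Hs.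
  destruct n as [|n]; [simpl; rewrite Rabs_R1; lra|].
  induction n as [|n IH].
  - simpl. rewrite Rminus_0_r, Rmult_1_l, Rdiv_1_r, Rabs_pos_eq; lra.
  - change (gbinom s (S (S n))) with (gbinom s (S n) * ((s - INR (S n)) / INR (S (S n)))).
    rewrite Rabs_mult. rewrite <- (Rmult_1_r 2).
    apply Rmult_le_compat; try apply Rabs_pos; [exact IH|].
    rewrite !S_INR. pose proof (pos_INR n). apply Rabs_le. split.
    + apply Rmult_le_reg_r with (INR n + 1 + 1); [lra|].
      unfold Rdiv. rewrite Rmult_assoc, Rinv_l; lra.
    + apply Rmult_le_reg_r with (INR n + 1 + 1); [lra|].
      unfold Rdiv. rewrite Rmult_assoc, Rinv_l; lra.
Qed.

Lemma gbinom_CV (s x : R) : 0 <= s <= 2 -> Rabs x < 1 -> Rbar_lt (Rabs x) (CV_radius (gbinom s)).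
Proof.
  intros Hs. apply CV_radius_of_bounded with 2. intros n. apply gbinom_bounded, Hs.
Qed.

Lemma gbinom_ode (s x : R) :
  0 <= s <= 2 -> Rabs x < 1 ->
  (1 + x) * PSeries (PS_derive (gbinom s)) x = s * PSeries (gbinom s) x.
Proof.
  intros Hs Hx. pose proof (gbinom_CV s x Hs Hx) as R.
  assert (ED : ex_pseries (PS_derive (gbinom s)) x).
  { apply CV_radius_inside. rewrite CV_radius_derive. exact R. }
  rewrite Rmult_plus_distr_r, Rmult_1_l, <- PSeries_incr_1, <- PSeries_plus, <- PSeries_scal.
  - apply PSeries_ext. intros n. unfold PS_plus, PS_scal, PS_incr_1, PS_derive, plus, scal; simpl.
    unfold mult; simpl. destruct n as [|n]; unfold zero; simpl.
    + field.
    + change (match n with O => 1 | S _ => INR n + 1 end) with (INR (S n)).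
      rewrite S_INR. pose proof (pos_INR n). field. lra.
  - exact ED.
  - apply ex_pseries_incr_1, ED.
Qed.

(** By [gbinom_ode] the sum [y] satisfies [(1 + x) y' = s y], so [y (1 + x)^(-s)] has derivative 0
    and keeps its value 1 at 0. The range of [s] covers both exponents [s] and [s + 1] that occur in
    [lambda_s]. *)
Lemma PSeries_gbinom (s x : R) :
  0 <= s <= 2 -> Rabs x < 1 -> PSeries (gbinom s) x = Rpower (1 + x) s.
Proof.
  intros Hs Hx. set (g := fun y => PSeries (gbinom s) y * Rpower (1 + y) (- s)).
  assert (D : forall y, Rabs y < 1 -> is_derive g y 0).
  { intros y Hy. pose proof (Rabs_def2 _ _ Hy) as B.
    pose proof (gbinom_ode s y Hs Hy) as O. evar_last.
    - apply @is_derive_mult.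
      + apply is_derive_PSeries, gbinom_CV; assumption.
      + apply (is_derive_comp (fun z => Rpower z (- s)) (fun z => 1 + z)).
        * apply is_derive_Rpower_base. lra.
        * auto_derive; [trivial|reflexivity].
      + intros; apply Rmult_comm.
    - unfold plus, mult, scal; simpl. unfold mult; simpl.
      replace (Rpower (1 + y) (- s)) with ((1 + y) * Rpower (1 + y) (- s - 1)).
      2: { rewrite <- (Rpower_1 (1 + y)) at 1 by lra. rewrite <- Rpower_plus. f_equal. ring. }
      replace (PSeries (PS_derive (gbinom s)) y * ((1 + y) * Rpower (1 + y) (- s - 1)))
        with ((1 + y) * PSeries (PS_derive (gbinom s)) y * Rpower (1 + y) (- s - 1)) by ring.
      rewrite O. ring. }
  assert (E : g x = 1).
  { assert (G0 : g 0 = 1).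
    { unfold g. rewrite PSeries_0, Rplus_0_r. unfold Rpower. rewrite ln_1, Rmult_0_r, exp_0.
      simpl. ring. }
    pose proof (Rabs_def2 _ _ Hx) as B.
    rewrite <- G0. destruct (Rtotal_order x 0) as [L|[->|L]]; [|reflexivity|].
    - apply (eq_is_derive g); [|exact L]. intros t Ht. apply D, Rabs_def1; lra.
    - symmetry. apply (eq_is_derive g); [|exact L]. intros t Ht. apply D, Rabs_def1; lra. }
  unfold g in E. rewrite Rpower_Ropp in E.
  pose proof (Rpower_pos (1 + x) s). apply Rmult_eq_reg_r with (/ Rpower (1 + x) s).
  - rewrite E, Rinv_r; lra.
  - apply Rinv_neq_0_compat. lra.
Qed.

Lemma sqr_lt_1 (t : R) : 0 < t < 1 -> Rabs (t ^ 2) < 1.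
Proof. intros Ht. rewrite Rabs_pos_eq; nra. Qed.

Lemma Rpower_even_part (s t : R) :
  0 <= s <= 2 -> 0 < t < 1 ->
  Rpower (1 + t) s + Rpower (1 - t) s = 2 + 2 * t ^ 2 * PSeries (fun n => gbinom s (2 * n + 2)) (t ^ 2).
Proof.
  intros Hs Ht.
  assert (EX : forall f : nat -> nat, ex_pseries (fun n => gbinom s (f n)) (t ^ 2)).
  { intros f. apply CV_radius_inside, CV_radius_of_bounded with 2; [|apply sqr_lt_1, Ht].
    intros n. apply gbinom_bounded, Hs. }
  rewrite <- (PSeries_gbinom s t) by (try rewrite Rabs_pos_eq; lra).
  replace (1 - t) with (1 + - t) by ring.
  rewrite <- (PSeries_gbinom s (- t)) by (try rewrite Rabs_Ropp, Rabs_pos_eq; lra).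
  rewrite (PSeries_odd_even (gbinom s) t), (PSeries_odd_even (gbinom s) (- t));
    try replace ((- t) ^ 2) with (t ^ 2) by ring.
  2-5: apply (EX (fun n => 2 * n)%nat) || apply (EX (fun n => 2 * n + 1)%nat).
  rewrite (PSeries_decr_1 (fun n => gbinom s (2 * n))) by apply (EX (fun n => 2 * n)%nat).
  rewrite (PSeries_ext (PS_decr_1 (fun n => gbinom s (2 * n))) (fun n => gbinom s (2 * n + 2))).
  2: { intros n. unfold PS_decr_1. f_equal. lia. }
  simpl (gbinom s (2 * 0)). ring.
Qed.

(* [weight s k] is proportional to the coefficient of [t^(2k+2)] in [(1 + t)^(s+1) + (1 - t)^(s+1)]. *)
Fixpoint weight (s : R) (n : nat) : R :=
  match n with
  | O => 1
  | S m => weight s m * (2 * INR m + 1 - s) * (2 * INR m + 2 - s)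
           / ((2 * INR m + 3) * (2 * INR m + 4))
  end.

Lemma gbinom_SS (s : R) (n : nat) :
  gbinom s (S (S n)) = gbinom s n * ((s - INR n) / (INR n + 1)) * ((s - (INR n + 1)) / (INR n + 2)).
Proof.
  change (gbinom s (S (S n))) with
    (gbinom s n * ((s - INR n) / INR (S n)) * ((s - INR (S n)) / INR (S (S n)))).
  rewrite !S_INR. replace (INR n + 1 + 1) with (INR n + 2) by ring. reflexivity.
Qed.

Lemma gbinom_succ_weight (s : R) (n : nat) :
  gbinom (s + 1) (2 * n + 2) = (s + 1) * s / 2 * weight s n.
Proof.
  induction n as [|n IH].
  - simpl. field.
  - replace (2 * S n + 2)%nat with (S (S (2 * n + 2))) by lia.
    rewrite gbinom_SS, IH, plus_INR, mult_INR. simpl (INR 2). pose proof (pos_INR n).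
    simpl weight. field. lra.
Qed.

(** Binomial coefficients of upper index [s] and [s + 1] and lower index [m] differ by the factor
    [(s + 1 - m)/(s + 1)]. Hence the same weights describe the numerator and the denominator of
    [lambda_s]. *)
Lemma gbinom_weight (s : R) (n : nat) :
  gbinom s (2 * n + 2) = - (s / 2) * ((2 * INR n + 1 - s) * weight s n).
Proof.
  induction n as [|n IH].
  - simpl. field.
  - replace (2 * S n + 2)%nat with (S (S (2 * n + 2))) by lia.
    rewrite gbinom_SS, IH, plus_INR, mult_INR. simpl (INR 2). pose proof (pos_INR n).
    rewrite S_INR. simpl weight. field. lra.
Qed.

Lemma weight_pos (s : R) (n : nat) : 0 < s < 1 -> 0 < weight s n.
Proof.
  intros Hs. induction n as [|n IH]; simpl; [lra|]. pose proof (pos_INR n).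
  apply Rdiv_lt_0_compat; repeat apply Rmult_lt_0_compat; lra.
Qed.

Lemma weight_le_1 (s : R) (n : nat) : 0 < s < 1 -> weight s n <= 1.
Proof.
  intros Hs. induction n as [|n IH]; simpl; [lra|]. pose proof (pos_INR n).
  pose proof (weight_pos s n Hs).
  apply Rmult_le_reg_r with ((2 * INR n + 3) * (2 * INR n + 4)); [nra|].
  unfold Rdiv. rewrite Rmult_assoc, Rinv_l by nra. rewrite Rmult_1_r, Rmult_1_l, Rmult_assoc.
  rewrite <- (Rmult_1_l ((2 * INR n + 3) * _)). apply Rmult_le_compat; nra.
Qed.

Lemma weight_mul_le_1 (s : R) (n : nat) : 0 < s < 1 -> (2 * INR n + 1 - s) * weight s n <= 1.
Proof.
  intros Hs. induction n as [|n IH]; [simpl; lra|]. rewrite S_INR. simpl weight.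
  pose proof (pos_INR n). pose proof (weight_pos s n Hs).
  replace ((2 * (INR n + 1) + 1 - s) * (weight s n * (2 * INR n + 1 - s) * (2 * INR n + 2 - s)
    / ((2 * INR n + 3) * (2 * INR n + 4)))) with (((2 * INR n + 1 - s) * weight s n)
    * ((2 * INR n + 3 - s) * (2 * INR n + 2 - s) / ((2 * INR n + 3) * (2 * INR n + 4)))) by (field; lra).
  apply Rle_trans with (1 * 1); [|lra]. apply Rmult_le_compat; [nra| |exact IH|].
  - apply Rdiv_le_0_compat; nra.
  - apply Rmult_le_reg_r with ((2 * INR n + 3) * (2 * INR n + 4)); [nra|].
    unfold Rdiv. rewrite Rmult_assoc, Rinv_l by nra. nra.
Qed.

Definition odd_inv (n : nat) : R := / (2 * INR n + 1).

Lemma odd_inv_bounded (n : nat) : Rabs (odd_inv n) <= 1.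
Proof.
  unfold odd_inv. pose proof (pos_INR n). rewrite Rabs_pos_eq.
  - rewrite <- Rinv_1. apply Rinv_le_contravar; lra.
  - apply Rlt_le, Rinv_0_lt_compat. lra.
Qed.

Lemma log_ratio_series (t : R) : 0 < t < 1 -> log_ratio t = 2 * t * PSeries odd_inv (t ^ 2).
Proof.
  intros Ht.
  set (g := fun x => log_ratio x - 2 * (x * PSeries odd_inv (x ^ 2))).
  assert (D : forall x, 0 <= x <= t -> is_derive g x 0).
  { intros x Hx. assert (Hz : Rabs (x ^ 2) < 1) by (rewrite Rabs_pos_eq; nra).
    assert (C : Rbar_lt (Rabs (x ^ 2)) (CV_radius odd_inv)).
    { apply CV_radius_of_bounded with 1; [apply odd_inv_bounded|exact Hz]. }
    assert (CD : ex_pseries (PS_derive odd_inv) (x ^ 2)).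
    { apply CV_radius_inside. rewrite CV_radius_derive. exact C. }
    evar_last.
    - apply @is_derive_minus; [apply is_derive_log_ratio; lra|].
      apply is_derive_scal. apply @is_derive_mult; [apply @is_derive_id| |intros; apply Rmult_comm].
      apply (is_derive_comp (PSeries odd_inv) (fun x => x ^ 2)).
      + apply is_derive_PSeries, C.
      + auto_derive; [trivial|reflexivity].
    - unfold minus, plus, opp, mult, scal, one; simpl. unfold mult; simpl.
      change (x * (x * 1)) with (x ^ 2).
      assert (E : PSeries odd_inv (x ^ 2) + 2 * (x ^ 2 * PSeries (PS_derive odd_inv) (x ^ 2))
        = / (1 - x ^ 2)).
      { rewrite <- PSeries_incr_1, <- PSeries_scal, <- PSeries_plus.
        - rewrite <- Series_geom by exact Hz. apply Series_ext. intros n.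
          rewrite <- (Rmult_1_l ((x ^ 2) ^ n)) at 2. f_equal.
          unfold PS_plus, PS_scal, PS_incr_1, PS_derive, plus, scal, zero, odd_inv; simpl.
          unfold mult; simpl. destruct n as [|n]; simpl; [field|].
          change (match n with O => 1 | S _ => INR n + 1 end) with (INR (S n)).
          rewrite S_INR. pose proof (pos_INR n). field. lra.
        - apply CV_radius_inside, C.
        - apply ex_pseries_scal; [apply Rmult_comm|]. apply ex_pseries_incr_1, CD. }
      assert (1 - x ^ 2 <> 0) by nra.
      replace (2 / (1 - x ^ 2)) with (2 * / (1 - x ^ 2)) by reflexivity. rewrite <- E. ring. }
  assert (G : g 0 = g t) by (apply (eq_is_derive g); [exact D|lra]).
  unfold g in G. destruct log_ratio_xlnx_0 as (E & _). rewrite E in G. lra.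
Qed.

(** Abel summation in inductive form: the partial sum with powers of [z] stays above [z^n] times the
    plain one, because lowering [z^n] to [z^(n+1)] in front of a nonnegative sum only loses. *)
Lemma PSeries_nonneg_of_partial_sums (a : nat -> R) (z : R) :
  0 <= z <= 1 -> ex_pseries a z -> (forall n, 0 <= sum_f_R0 a n) -> 0 <= PSeries a z.
Proof.
  intros Hz Ex H.
  assert (P : forall n, z ^ n * sum_f_R0 a n <= sum_f_R0 (fun k => a k * z ^ k) n).
  { induction n as [|n IH]; simpl; [lra|].
    assert (z * (z ^ n * sum_f_R0 a n) <= z ^ n * sum_f_R0 a n).
    { rewrite <- (Rmult_1_l (z ^ n * sum_f_R0 a n)) at 2. apply Rmult_le_compat_r; [|lra].
      apply Rmult_le_pos; [apply pow_le; lra|apply H]. }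
    lra. }
  apply ex_pseries_R in Ex. apply Series_correct in Ex.
  apply (is_lim_seq_le (fun _ => 0) (sum_n (fun k => a k * z ^ k)) 0 (PSeries a z)).
  - intros n. rewrite sum_n_Reals. apply Rle_trans with (2 := P n).
    apply Rmult_le_pos; [apply pow_le; lra|apply H].
  - apply is_lim_seq_const.
  - exact Ex.
Qed.

(** Let [z = t^2] and let [W], [O], [V] be the power series with coefficients [weight s n],
    [odd_inv n] and [(2 n + 1 - s) weight s n]. Then [1 / L = O(z)] and
    [lambda_s = (1 - s) W(z) / V(z)], and [excess] lists the coefficients of [(1 - s) W O - V]. *)
Definition excess (s : R) (n : nat) : R :=
  (1 - s) * PS_mult (weight s) odd_inv n - (2 * INR n + 1 - s) * weight s n.

Lemma logmean_le_lambda_of_excess (s : R) :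
  0 < s < 1 -> (forall n, 0 <= sum_f_R0 (excess s) n) ->
  forall a b, 0 < a -> 0 < b -> logmean a b <= lambda s a b.
Proof.
  intros Hs H. apply homogeneous_mean_le.
  { apply homogeneous_mean_logmean. } { apply homogeneous_mean_lambda. }
  intros t Ht. pose proof (sqr_lt_1 t Ht) as Hz. set (z := t ^ 2) in *.
  set (V := fun n => (2 * INR n + 1 - s) * weight s n).
  assert (CW : Rbar_lt (Rabs z) (CV_radius (weight s))).
  { apply CV_radius_of_bounded with 1; [|exact Hz]. intros n.
    rewrite Rabs_pos_eq by (apply Rlt_le, weight_pos, Hs). apply weight_le_1, Hs. }
  assert (CV : Rbar_lt (Rabs z) (CV_radius V)).
  { apply CV_radius_of_bounded with 1; [|exact Hz]. intros n. unfold V.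
    pose proof (pos_INR n). pose proof (weight_pos s n Hs).
    rewrite Rabs_pos_eq by nra. apply weight_mul_le_1, Hs. }
  assert (CO : Rbar_lt (Rabs z) (CV_radius odd_inv)).
  { apply CV_radius_of_bounded with 1; [apply odd_inv_bounded|exact Hz]. }
  pose proof (log_ratio_ge t ltac:(lra)) as He.
  assert (HE : PSeries V z <= (1 - s) * (PSeries (weight s) z * PSeries odd_inv z)).
  { assert (N : 0 <= PSeries (excess s) z).
    { apply PSeries_nonneg_of_partial_sums; [unfold z; nra| |exact H].
      apply ex_pseries_ext with (PS_minus (PS_scal (1 - s) (PS_mult (weight s) odd_inv)) V).
      { intros n. reflexivity. }
      apply ex_pseries_minus; [|apply CV_radius_inside, CV].
      apply ex_pseries_scal; [apply Rmult_comm|]. apply ex_pseries_mult; assumption. }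
    rewrite (PSeries_ext _ (PS_minus (PS_scal (1 - s) (PS_mult (weight s) odd_inv)) V)) in N
      by reflexivity.
    rewrite PSeries_minus, PSeries_scal, PSeries_mult in N; try assumption; [lra| |].
    - apply ex_pseries_scal; [apply Rmult_comm|]. apply ex_pseries_mult; assumption.
    - apply CV_radius_inside, CV. }
  rewrite (log_ratio_series t Ht) in He. fold z in He.
  pose proof (Rpower_even_part (s + 1) t ltac:(lra) Ht) as E1.
  pose proof (Rpower_even_part s t ltac:(lra) Ht) as E0. fold z in E0, E1.
  rewrite (PSeries_ext (fun n => gbinom (s + 1) (2 * n + 2)) (PS_scal ((s + 1) * s / 2) (weight s))) in E1
    by (intros n; apply gbinom_succ_weight).
  rewrite (PSeries_ext (fun n => gbinom s (2 * n + 2)) (PS_scal (- (s / 2)) V)) in E0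
    by (intros n; apply gbinom_weight).
  rewrite PSeries_scal in E0, E1.
  pose proof (phi_pos s (1 - t) (1 + t) ltac:(lra) ltac:(lra) ltac:(lra)) as P0.
  revert P0. unfold phi, gap, potential, logmean, lambda, lambda_ne, amean.
  replace ((1 - t + (1 + t)) / 2) with 1 by field.
  destruct (Req_EM_T (1 - t) (1 + t)); [lra|].
  destruct (Req_EM_T s (-1)); [lra|]. destruct (Req_EM_T s 0); [lra|].
  destruct (Req_EM_T s 1); [lra|].
  assert (Q1 : forall r, Rpower 1 r = 1) by (intros r; unfold Rpower; rewrite ln_1, Rmult_0_r; apply exp_0).
  rewrite !Q1. fold (log_ratio t). rewrite (log_ratio_series t Ht). fold z.
  replace (Rpower (1 - t) (s + 1) + Rpower (1 + t) (s + 1) - 2 * 1)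
    with (2 * z * ((s + 1) * s / 2 * PSeries (weight s) z)) by lra.
  replace (Rpower (1 - t) s + Rpower (1 + t) s - 2 * 1)
    with (2 * z * (- (s / 2) * PSeries V z)) by lra.
  intros P0.
  replace ((Rpower (1 - t) s / s - (1 - t)) / (s - 1) + (Rpower (1 + t) s / s - (1 + t)) / (s - 1)
    - 2 * ((1 / s - 1) / (s - 1))) with ((Rpower (1 + t) s + Rpower (1 - t) s - 2) / (s * (s - 1))) in P0
    by (field; lra).
  rewrite E0 in P0.
  replace ((2 + 2 * z * (- (s / 2) * PSeries V z) - 2) / (s * (s - 1)))
    with (z * PSeries V z * / (1 - s)) in P0 by (field; lra).
  assert (HzP : 0 < z) by (unfold z; nra).
  (* The quantity in [P0] is [phi s (1 - t) (1 + t)], so strict convexity supplies the sign of the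
     denominator. *)
  assert (HV : 0 < PSeries V z).
  { destruct (Rlt_or_le 0 (PSeries V z)) as [|N]; [assumption|].
    pose proof (Rinv_0_lt_compat (1 - s) ltac:(lra)).
    assert (0 < PSeries V z * / (1 - s)); nra. }
  assert (HO : 0 < PSeries odd_inv z) by nra.
  replace (1 + t - (1 - t)) with (2 * t) by ring.
  apply Rle_trans with (/ PSeries odd_inv z); [apply Req_le; field; lra|].
  replace ((s - 1) / (s + 1) * (2 * z * ((s + 1) * s / 2 * PSeries (weight s) z)
    / (2 * z * (- (s / 2) * PSeries V z)))) with ((1 - s) * PSeries (weight s) z / PSeries V z)
    by (field; lra).
  apply Rmult_le_reg_r with (PSeries odd_inv z * PSeries V z); [nra|].
  replace (/ PSeries odd_inv z * (PSeries odd_inv z * PSeries V z)) with (PSeries V z) by (field; lra).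
  replace ((1 - s) * PSeries (weight s) z / PSeries V z * (PSeries odd_inv z * PSeries V z))
    with ((1 - s) * (PSeries (weight s) z * PSeries odd_inv z)) by (field; lra).
  exact HE.
Qed.

(** * Positivity of the partial sums for s = 29/320 *)

Definition envelope (s : R) (n : nat) : R :=
  (2 * INR n + 1) * (2 * INR n + 1 - s) * weight s n.

Lemma envelope_decreasing (s : R) (N n : nat) :
  / 12 <= s < 1 -> (6 <= N <= n)%nat -> envelope s n <= envelope s N.
Proof.
  intros Hs [HN Hn]. induction Hn as [|n Hn IH]; [apply Rle_refl|].
  apply Rle_trans with (2 := IH). unfold envelope. simpl weight. rewrite S_INR.
  assert (6 <= INR n). { replace 6 with (INR 6) by (simpl; ring). apply le_INR. lia. }
  pose proof (weight_pos s n ltac:(lra)).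
  replace (2 * (INR n + 1) + 1) with (2 * INR n + 3) by ring.
  replace ((2 * INR n + 3) * (2 * INR n + 3 - s) * (weight s n * (2 * INR n + 1 - s) *
    (2 * INR n + 2 - s) / ((2 * INR n + 3) * (2 * INR n + 4)))) with
    ((2 * INR n + 1 - s) * weight s n * ((2 * INR n + 3 - s) * (2 * INR n + 2 - s) / (2 * INR n + 4)))
    by (field; lra).
  replace ((2 * INR n + 1) * (2 * INR n + 1 - s) * weight s n) with
    ((2 * INR n + 1 - s) * weight s n * (2 * INR n + 1)) by ring.
  apply Rmult_le_compat_l; [nra|]. apply Rmult_le_reg_r with (2 * INR n + 4); [lra|].
  (* What remains is [2 + s^2 <= s (4 n + 5)], which follows from [1/12 <= s < 1] and [n >= 6]. *)
  unfold Rdiv. rewrite Rmult_assoc, Rinv_l by lra. nra.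
Qed.

Lemma sum_f_R0_mono_bound (f : nat -> R) (N n : nat) :
  (forall k, 0 <= f k) -> (N <= n)%nat -> sum_f_R0 f N <= sum_f_R0 f n.
Proof.
  intros H Hn. induction Hn as [|n Hn IH]; [apply Rle_refl|]. simpl. pose proof (H (S n)). lra.
Qed.

(** Every [odd_inv (n - k)] is at least [1 / (2 n + 1)], so [(2 n + 1) excess s n] is at least
    [1 - s] times the sum of the weights, minus [envelope s n]. The sum grows with [n] and the
    envelope decreases, so one comparison at [N] settles the whole tail. *)
Lemma excess_nonneg (s : R) (N n : nat) :
  / 12 <= s < 1 -> (6 <= N <= n)%nat ->
  envelope s N <= (1 - s) * sum_f_R0 (weight s) N -> 0 <= excess s n.
Proof.
  intros Hs Hn H. pose proof (envelope_decreasing s N n Hs Hn) as E. unfold excess.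
  pose proof (pos_INR n).
  assert (W : forall k, 0 <= weight s k) by (intros k; apply Rlt_le, weight_pos; lra).
  pose proof (sum_f_R0_mono_bound (weight s) N n W ltac:(lia)) as M.
  assert (C : sum_f_R0 (weight s) n * / (2 * INR n + 1) <= PS_mult (weight s) odd_inv n).
  { unfold PS_mult. rewrite Rmult_comm, scal_sum. apply sum_Rle. intros k Hk.
    apply Rmult_le_compat_l; [apply W|]. unfold odd_inv. pose proof (pos_INR (n - k)).
    apply Rinv_le_contravar; [lra|]. apply Rplus_le_compat_r, Rmult_le_compat_l; [lra|].
    apply le_INR. lia. }
  apply Rmult_le_reg_r with (2 * INR n + 1); [lra|]. rewrite Rmult_0_l.
  apply (Rmult_le_compat_r (2 * INR n + 1)) in C; [|lra].
  rewrite Rmult_assoc, Rinv_l in C by lra. unfold envelope in E, H.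
  assert ((1 - s) * sum_f_R0 (weight s) N <= (1 - s) * (PS_mult (weight s) odd_inv n * (2 * INR n + 1)))
    by (apply Rmult_le_compat_l; lra).
  unfold envelope in *. lra.
Qed.

(* Fixed-point bounds, in units of [2^-36], for [s = p / q]: [l] lists lower bounds of
   [weight s n, ..., weight s 0], [hi] is an upper bound of [weight s n], and [S] is a lower bound
   of [q] times the [n]-th partial sum of the excess. *)
Definition unit_scale : Z := 2 ^ 36.

Fixpoint conv_low (l : list Z) (j : Z) : Z :=
  match l with
  | [] => 0%Z
  | x :: l' => (x / (2 * j + 1) + conv_low l' (j + 1))%Z
  end.

Definition list_sum (l : list Z) : Z := fold_right Z.add 0%Z l.

Fixpoint partial_sums_check (p q : Z) (fuel : nat) (n lo : Z) (l : list Z) (hi S : Z) : bool :=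
  match fuel with
  | O => ((2 * n + 1) * ((2 * n + 1) * q - p) * hi <=? (q - p) * list_sum (lo :: l))%Z
  | Datatypes.S fuel' =>
      let num := (((2 * n + 1) * q - p) * ((2 * n + 2) * q - p))%Z in
      let den := (q * q * ((2 * n + 3) * (2 * n + 4)))%Z in
      let lo' := (lo * num / den)%Z in
      let hi' := (hi * num / den + 1)%Z in
      let S' := (S + (q - p) * conv_low (lo' :: lo :: l) 0 - ((2 * n + 3) * q - p) * hi')%Z in
      if (0 <=? S')%Z then partial_sums_check p q fuel' (n + 1) lo' (lo :: l) hi' S' else false
  end.

(** * Soundness of the fixed-point computation *)

Lemma IZR_div_bounds (x y : Z) :
  (0 < y)%Z -> IZR (x / y) <= IZR x / IZR y <= IZR (x / y + 1).
Proof.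
  intros Hy. pose proof (IZR_lt 0 y Hy) as Hy'.
  assert (D : (y * (x / y) <= x)%Z) by (apply Z.mul_div_le; exact Hy).
  assert (U : (x <= y * (x / y + 1))%Z).
  { pose proof (Z.mul_succ_div_gt x y Hy). unfold Z.succ in *. lia. }
  apply IZR_le in D, U. rewrite mult_IZR in D, U.
  split; apply Rmult_le_reg_r with (IZR y); try exact Hy';
    unfold Rdiv; rewrite ?Rmult_assoc, ?Rinv_l by lra; lra.
Qed.

Fixpoint lower_bounds (f : nat -> R) (n : nat) (l : list Z) {struct l} : Prop :=
  match l with
  | [] => False
  | x :: l' => IZR x <= f n /\
      match n with O => l' = [] | S m => lower_bounds f m l' end
  end.

(** The list starts with the highest index, so passing to its tail lowers [n] while the denominators
    continue from [j + 1]; the offset [j] carries the induction. *)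
Lemma conv_low_correct (f : nat -> R) (n j : nat) (l : list Z) :
  lower_bounds f n l ->
  IZR (conv_low l (Z.of_nat j)) <= sum_f_R0 (fun k => f k * odd_inv (j + (n - k))) n.
Proof.
  assert (D : forall i x m, IZR x <= f m -> IZR (x / (2 * Z.of_nat i + 1)) <= f m * odd_inv i).
  { intros i x m Hx. pose proof (IZR_div_bounds x (2 * Z.of_nat i + 1) ltac:(lia)) as [B _].
    apply Rle_trans with (1 := B). unfold odd_inv, Rdiv.
    rewrite plus_IZR, mult_IZR, <- INR_IZR_INZ. apply Rmult_le_compat_r; [|exact Hx].
    pose proof (pos_INR i). apply Rlt_le, Rinv_0_lt_compat. lra. }
  revert j l. induction n as [|n IH]; intros j [|x l] Hl; try contradiction.
  - destruct Hl as [Hx ->]. cbn [conv_low]. rewrite Z.add_0_r. simpl sum_f_R0.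
    rewrite Nat.add_0_r. apply D, Hx.
  - destruct Hl as [Hx Hl]. cbn [conv_low]. rewrite plus_IZR. rewrite tech5, Nat.sub_diag, Nat.add_0_r.
    replace (Z.of_nat j + 1)%Z with (Z.of_nat (S j)) by lia.
    pose proof (D j x (S n) Hx). pose proof (IH (S j) l Hl) as I.
    rewrite (sum_eq _ (fun k => f k * odd_inv (S j + (n - k))) n); [lra|].
    intros k Hk. do 2 f_equal. lia.
Qed.

Lemma list_sum_correct (f : nat -> R) (n : nat) (l : list Z) :
  lower_bounds f n l -> IZR (list_sum l) <= sum_f_R0 f n.
Proof.
  revert l. induction n as [|n IH]; intros [|x l] Hl; try contradiction.
  - destruct Hl as [Hx ->]. simpl. rewrite Z.add_0_r. exact Hx.
  - destruct Hl as [Hx Hl]. unfold list_sum. simpl fold_right. rewrite plus_IZR, tech5.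
    pose proof (IH l Hl) as I. unfold list_sum in I. lra.
Qed.

(** All roundings err on the safe side: the convolution enters positively and uses lower bounds, the
    subtracted term uses the upper bound. Here [c] is the scale and the factor [q] clears the
    denominator of [s]. When the fuel runs out, the last test yields the tail hypothesis of
    [excess_nonneg]. *)
Lemma partial_sums_check_correct (p q : Z) (s c : R) (fuel n : nat) (lo : Z) (l : list Z) (hi S : Z) :
  (0 < p < q)%Z -> s = IZR p / IZR q -> 0 < c ->
  lower_bounds (fun k => c * weight s k) n (lo :: l) -> c * weight s n <= IZR hi ->
  IZR S <= c * IZR q * sum_f_R0 (excess s) n ->
  partial_sums_check p q fuel (Z.of_nat n) lo l hi S = true ->
  (forall m, (n < m <= n + fuel)%nat -> 0 <= sum_f_R0 (excess s) m) /\
  envelope s (n + fuel) <= (1 - s) * sum_f_R0 (weight s) (n + fuel).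
Proof.
  intros Hpq Hs Hc. assert (Hp : 0 < IZR p < IZR q) by (split; apply IZR_lt; lia).
  assert (Es : s * IZR q = IZR p) by (rewrite Hs; field; lra).
  assert (Hs1 : 0 < s < 1) by nra.
  revert n lo l hi S. induction fuel as [|fuel IH]; intros n lo l hi S Hl Hhi HS Hck.
  - split; [intros m Hm; lia|]. rewrite Nat.add_0_r.
    cbn [partial_sums_check] in Hck. apply Z.leb_le, IZR_le in Hck.
    rewrite !mult_IZR, !minus_IZR, !mult_IZR, !plus_IZR, !mult_IZR, <- INR_IZR_INZ in Hck.
    apply list_sum_correct in Hl.
    rewrite (sum_eq _ (fun k => weight s k * c)), <- scal_sum in Hl by (intros; ring).
    pose proof (pos_INR n). unfold envelope.
    apply Rmult_le_reg_r with (c * IZR q); [nra|].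
    replace ((2 * INR n + 1) * (2 * INR n + 1 - s) * weight s n * (c * IZR q)) with
      ((2 * INR n + 1) * ((2 * INR n + 1) * IZR q - IZR p) * (c * weight s n)) by (rewrite <- Es; ring).
    replace ((1 - s) * sum_f_R0 (weight s) n * (c * IZR q)) with
      ((IZR q - IZR p) * (c * sum_f_R0 (weight s) n)) by (rewrite <- Es; ring).
    apply Rle_trans with ((2 * INR n + 1) * ((2 * INR n + 1) * IZR q - IZR p) * IZR hi).
    + apply Rmult_le_compat_l; [|exact Hhi]. apply Rmult_le_pos; nra.
    + apply Rle_trans with (1 := Hck). apply Rmult_le_compat_l; lra.
  - cbn [partial_sums_check] in Hck. revert Hck.
    set (num := (((2 * Z.of_nat n + 1) * q - p) * ((2 * Z.of_nat n + 2) * q - p))%Z).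
    set (den := (q * q * ((2 * Z.of_nat n + 3) * (2 * Z.of_nat n + 4)))%Z).
    cbv zeta.
    set (lo' := (lo * num / den)%Z). set (hi' := (hi * num / den + 1)%Z).
    set (S' := (S + (q - p) * conv_low (lo' :: lo :: l) 0 - ((2 * Z.of_nat n + 3) * q - p) * hi')%Z).
    destruct (Z.leb_spec 0 S') as [HS'|]; [|discriminate]. intros Hck.
    pose proof (pos_INR n) as Hn.
    assert (Hden : (0 < den)%Z) by (unfold den; repeat apply Z.mul_pos_pos; lia).
    assert (Hnum : (0 < num)%Z) by (unfold num; apply Z.mul_pos_pos; nia).
    assert (Hd : 0 < IZR den) by (apply IZR_lt, Hden).
    assert (Hnm : 0 < IZR num) by (apply IZR_lt, Hnum).
    assert (Hw : weight s (Datatypes.S n) = weight s n * (IZR num / IZR den)).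
    { simpl weight. unfold num, den.
      rewrite !mult_IZR, !minus_IZR, !mult_IZR, !plus_IZR, !mult_IZR, <- INR_IZR_INZ, <- Es.
      field. lra. }
    assert (Hlo' : IZR lo' <= c * weight s (Datatypes.S n)).
    { destruct (IZR_div_bounds (lo * num) den Hden) as [B _]. apply Rle_trans with (1 := B).
      rewrite mult_IZR, Hw, <- Rmult_assoc. unfold Rdiv at 1. rewrite (Rmult_assoc (IZR lo)).
      apply Rmult_le_compat_r; [apply Rlt_le, Rdiv_lt_0_compat; assumption|]. apply Hl. }
    assert (Hhi' : c * weight s (Datatypes.S n) <= IZR hi').
    { destruct (IZR_div_bounds (hi * num) den Hden) as [_ B]. apply Rle_trans with (2 := B).
      rewrite mult_IZR, Hw, <- Rmult_assoc. unfold Rdiv at 2. rewrite (Rmult_assoc (IZR hi)).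
      apply Rmult_le_compat_r; [apply Rlt_le, Rdiv_lt_0_compat; assumption|]. exact Hhi. }
    assert (Hl' : lower_bounds (fun k => c * weight s k) (Datatypes.S n) (lo' :: lo :: l))
      by (split; assumption).
    assert (HSr : IZR S' <= c * IZR q * sum_f_R0 (excess s) (Datatypes.S n)).
    { pose proof (conv_low_correct _ (Datatypes.S n) 0 _ Hl') as HC.
      rewrite (sum_eq _ (fun k => weight s k * odd_inv (Datatypes.S n - k) * c)), <- scal_sum in HC
        by (intros; simpl; ring).
      change (sum_f_R0 (fun k => weight s k * odd_inv (Datatypes.S n - k)) (Datatypes.S n))
        with (PS_mult (weight s) odd_inv (Datatypes.S n)) in HC.
      change (Z.of_nat 0) with 0%Z in HC.
      rewrite tech5. unfold S'. rewrite minus_IZR, plus_IZR, !mult_IZR, !minus_IZR, !mult_IZR, !plus_IZR, !mult_IZR,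
        <- INR_IZR_INZ.
      unfold excess at 2. rewrite S_INR.
      set (C := PS_mult (weight s) odd_inv (Datatypes.S n)) in *.
      set (w := weight s (Datatypes.S n)) in *.
      replace (c * IZR q * (sum_f_R0 (excess s) n + ((1 - s) * C - (2 * (INR n + 1) + 1 - s) * w)))
        with (c * IZR q * sum_f_R0 (excess s) n + (IZR q - IZR p) * (c * C)
          - ((2 * INR n + 3) * IZR q - IZR p) * (c * w)) by (rewrite <- Es; ring).
      assert ((IZR q - IZR p) * IZR (conv_low (lo' :: lo :: l) 0) <= (IZR q - IZR p) * (c * C))
        by (apply Rmult_le_compat_l; lra).
      assert (((2 * INR n + 3) * IZR q - IZR p) * (c * w) <= ((2 * INR n + 3) * IZR q - IZR p) * IZR hi')
        by (apply Rmult_le_compat_l; [nra|exact Hhi']).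
      lra. }
    replace (Z.of_nat n + 1)%Z with (Z.of_nat (Datatypes.S n)) in Hck by lia.
    destruct (IH (Datatypes.S n) lo' (lo :: l) hi' S' Hl' Hhi' HSr Hck) as [I1 I2].
    replace (n + Datatypes.S fuel)%nat with (Datatypes.S n + fuel)%nat by lia.
    split; [|exact I2]. intros m Hm.
    destruct (Nat.eq_dec m (Datatypes.S n)) as [->|Hne]; [|apply I1; lia].
    apply IZR_le in HS'. apply Rmult_le_reg_l with (c * IZR q); [nra|]. lra.
Qed.

Lemma excess_partial_sums (n : nat) : 0 <= sum_f_R0 (excess (29 / 320)) n.
Proof.
  assert (E0 : excess (29 / 320) 0 = 0) by (unfold excess, PS_mult, odd_inv; simpl; field).
  (* The run starts from exact data: [weight s 0 = 1] is one full scale and the zeroth excess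
     vanishes, as both means agree at [a = b]. After 76 steps the tail test holds, and all later
     summands are nonnegative. *)
  destruct (partial_sums_check_correct 29 320 (29 / 320) (IZR unit_scale) 76 0 unit_scale []
    unit_scale 0) as [H1 H2].
  - lia.
  - reflexivity.
  - apply IZR_lt. reflexivity.
  - split; [simpl; lra|reflexivity].
  - simpl weight. lra.
  - simpl sum_f_R0. rewrite E0. lra.
  - vm_compute. reflexivity.
  - simpl Nat.add in H1, H2. induction n as [|n IH]; [simpl; rewrite E0; lra|].
    destruct (Nat.le_gt_cases (S n) 76) as [Hn|Hn]; [apply H1; lia|].
    rewrite tech5. pose proof (excess_nonneg (29 / 320) 76 (S n) ltac:(lra) ltac:(lia) H2). lra.
Qed.

Lemma logmean_le_lambda (s a b : R) :
  29 / 320 <= s -> 0 < a -> 0 < b -> logmean a b <= lambda s a b.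
Proof.
  intros Hs Ha Hb. apply Rle_trans with (lambda (29 / 320) a b).
  - apply logmean_le_lambda_of_excess; [lra|apply excess_partial_sums|exact Ha|exact Hb].
  - apply lambda_mono; assumption.
Qed.

(** * The threshold *)

Lemma ln_5_4_le : ln (5 / 4) <= 22315 / 100000.
Proof.
  assert (H : 5 / 4 <= exp (22315 / 100000)).
  { apply Rle_trans with (2 := exp_ge_taylor (22315 / 100000) 5 ltac:(lra)). simpl. lra. }
  rewrite <- (ln_exp (22315 / 100000)). apply ln_le; lra.
Qed.

Lemma Rpower_pow_div (y x : R) (n k : nat) :
  0 < y -> INR n * x = INR k -> Rpower (y ^ n) x = y ^ k.
Proof.
  intros Hy E. rewrite <- !Rpower_pow by exact Hy. rewrite Rpower_mult, E. reflexivity.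
Qed.

(** The 23rd power makes [a^s = (4/5)^2] and [a^(s+1) = (4/5)^25] rational. Only [ln (5/4)] and
    [z = m^(2/23)] are left, and since [lambda] decreases in [z] and [L] in the logarithm, a lower
    bound for [z] and an upper bound for the logarithm suffice. *)
Lemma lambda_lt_logmean : lambda (2 / 23) ((4 / 5) ^ 23) 1 < logmean ((4 / 5) ^ 23) 1.
Proof.
  assert (Ha : (4 / 5) ^ 23 < 1) by (simpl; lra).
  unfold lambda, lambda_ne, logmean, amean.
  destruct (Req_EM_T ((4 / 5) ^ 23) 1); [lra|].
  destruct (Req_EM_T (2 / 23) (-1)); [lra|]. destruct (Req_EM_T (2 / 23) 0); [lra|].
  destruct (Req_EM_T (2 / 23) 1); [lra|].
  rewrite (Rpower_pow_div (4 / 5) (2 / 23) 23 2) by (simpl; lra).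
  rewrite (Rpower_pow_div (4 / 5) (2 / 23 + 1) 23 25) by (simpl; lra).
  assert (Q1 : forall r, Rpower 1 r = 1) by (intros r; unfold Rpower; rewrite ln_1, Rmult_0_r; apply exp_0).
  rewrite !Q1, ln_1.
  assert (L : 0 - ln ((4 / 5) ^ 23) = 23 * ln (5 / 4)).
  { rewrite ln_pow by lra. replace (4 / 5) with (/ (5 / 4)) by field.
    rewrite ln_Rinv by lra. replace (INR 23) with 23 by (simpl; ring). ring. }
  rewrite L. pose proof ln_5_4_le as HL.
  assert (HL0 : 0 < ln (5 / 4)) by (rewrite <- ln_1; apply ln_increasing; lra).
  set (m := ((4 / 5) ^ 23 + 1) / 2). assert (Hm : 0 < m < 1) by (unfold m; simpl; lra).
  rewrite Rpower_plus, Rpower_1 by lra. set (z := Rpower m (2 / 23)).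
  (* A rational number just below [z], verified through [z^23 = m^2]. *)
  assert (Hz : 94198 / 100000 <= z).
  { apply Rnot_lt_le. intros H.
    assert (H23 : z ^ 23 = m ^ 2).
    { unfold z. rewrite <- (Rpower_pow 23) by apply Rpower_pos. rewrite Rpower_mult.
      rewrite <- (Rpower_pow 2) by lra. f_equal. simpl. field. }
    assert (z ^ 23 <= (94198 / 100000) ^ 23).
    { apply pow_incr. split; [apply Rlt_le, Rpower_pos|lra]. }
    rewrite H23 in H0. unfold m in H0. simpl in H0. lra. }
  replace ((2 / 23 - 1) / (2 / 23 + 1) * (((4 / 5) ^ 25 + 1 - 2 * (z * m)) / ((4 / 5) ^ 2 + 1 - 2 * z)))
    with (21 / 25 * ((4 / 5) ^ 25 + 1 - 2 * (z * m)) / (2 * z - 41 / 25)) by (field; lra).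
  apply Rmult_lt_reg_r with ((2 * z - 41 / 25) * (23 * ln (5 / 4))); [apply Rmult_lt_0_compat; lra|].
  replace (21 / 25 * ((4 / 5) ^ 25 + 1 - 2 * (z * m)) / (2 * z - 41 / 25) * ((2 * z - 41 / 25) * (23 * ln (5 / 4))))
    with (21 / 25 * ((4 / 5) ^ 25 + 1 - 2 * (z * m)) * (23 * ln (5 / 4))) by (field; lra).
  replace ((1 - (4 / 5) ^ 23) / (23 * ln (5 / 4)) * ((2 * z - 41 / 25) * (23 * ln (5 / 4))))
    with ((1 - (4 / 5) ^ 23) * (2 * z - 41 / 25)) by (field; lra).
  apply Rle_lt_trans with
    (21 / 25 * ((4 / 5) ^ 25 + 1 - 2 * (94198 / 100000 * m)) * (23 * (22315 / 100000))).
  - apply Rle_trans with (21 / 25 * ((4 / 5) ^ 25 + 1 - 2 * (94198 / 100000 * m)) * (23 * ln (5 / 4))).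
    + apply Rmult_le_compat_r; [lra|].
      pose proof (Rmult_le_compat_r m _ _ ltac:(lra) Hz). lra.
    + apply Rmult_le_compat_l; [|lra]. unfold m. simpl. lra.
  - apply Rlt_le_trans with ((1 - (4 / 5) ^ 23) * (2 * (94198 / 100000) - 41 / 25)).
    + unfold m. simpl. lra.
    + apply Rmult_le_compat_l; lra.
Qed.

Lemma lambda_continuous (s a b : R) :
  0 < s < 1 -> 0 < a -> 0 < b -> a <> b ->
  continuous (fun s => (s - 1) / (s + 1) *
    ((Rpower a (s + 1) + Rpower b (s + 1) - 2 * Rpower (amean a b) (s + 1)) /
     (Rpower a s + Rpower b s - 2 * Rpower (amean a b) s))) s.
Proof.
  intros Hs Ha Hb Hab.
  assert (N : Rpower a s + Rpower b s - 2 * Rpower (amean a b) s <> 0).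
  { intros E. pose proof (phi_pos s a b Ha Hb Hab) as P. revert P.
    unfold phi, gap, potential. destruct (Req_EM_T s 0); [lra|]. destruct (Req_EM_T s 1); [lra|].
    fold (amean a b).
    match goal with |- 0 < ?x -> _ => replace x with
      ((Rpower a s + Rpower b s - 2 * Rpower (amean a b) s) / (s * (s - 1))) end.
    - rewrite E. unfold Rdiv. lra.
    - unfold amean at 3. field. lra. }
  apply @ex_derive_continuous. unfold Rpower in *. auto_derive. repeat split; lra.
Qed.

(** This makes the infimum of the admissible parameters admissible. A violation at [s] would persist
    slightly to the right; the witness [r] stays below 1, where the generic formula applies. *)
Lemma lambda_continuous_le (s c a b : R) :
  0 < s < 1 -> 0 < a -> 0 < b ->
  (forall r, s < r -> c <= lambda r a b) -> c <= lambda s a b.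
Proof.
  intros Hs Ha Hb H. unfold lambda in *. destruct (Req_EM_T a b) as [E|Hab].
  { apply (H 1). lra. }
  set (f := fun s => (s - 1) / (s + 1) *
    ((Rpower a (s + 1) + Rpower b (s + 1) - 2 * Rpower (amean a b) (s + 1)) /
     (Rpower a s + Rpower b s - 2 * Rpower (amean a b) s))).
  assert (F : forall r, 0 < r < 1 -> lambda_ne r a b = f r).
  { intros r Hr. unfold lambda_ne. destruct (Req_EM_T r (-1)); [lra|].
    destruct (Req_EM_T r 0); [lra|]. destruct (Req_EM_T r 1); [lra|]. reflexivity. }
  rewrite F by exact Hs. apply Rnot_lt_le. intros L.
  pose proof (lambda_continuous s a b Hs Ha Hb Hab) as C. fold f in C.
  assert (N : locally s (fun r => f r < c)) by exact (C (fun y => y < c) (open_lt c (f s) L)).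
  destruct N as [d Hd]. pose proof (cond_pos d).
  set (r := s + Rmin (d / 2) ((1 - s) / 2)).
  assert (Hr : s < r < 1 /\ r < s + d).
  { pose proof (Rmin_l (d / 2) ((1 - s) / 2)). pose proof (Rmin_r (d / 2) ((1 - s) / 2)).
    assert (0 < Rmin (d / 2) ((1 - s) / 2)) by (apply Rmin_glb_lt; lra). unfold r. lra. }
  assert (B : f r < c).
  { apply Hd. unfold ball; simpl; unfold AbsRing_ball, abs, minus, plus, opp; simpl.
    rewrite Rabs_pos_eq; lra. }
  pose proof (H r ltac:(lra)) as G. rewrite F in G by lra. lra.
Qed.

Theorem theorem3 :
  exists s0 : R,
    1 / 12 < s0 < 1 / 11 /\
    (forall s : R, s0 <= s <= 1 ->
       forall a b : R, 0 < a -> 0 < b ->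
         logmean a b <= lambda s a b <= identric a b) /\
    (forall s : R,
       (forall a b : R, 0 < a -> 0 < b -> logmean a b <= lambda s a b) <-> s0 <= s) /\
    (forall s : R,
       (forall a b : R, 0 < a -> 0 < b -> lambda s a b <= identric a b) <-> s <= 1).
Proof.
  set (T := fun s => forall a b : R, 0 < a -> 0 < b -> logmean a b <= lambda s a b).
  assert (T_lower : forall s, T s -> 2 / 23 < s).
  { intros s Hs. apply Rnot_le_lt. intros L.
    assert (Hp : 0 < (4 / 5) ^ 23) by (apply pow_lt; lra).
    pose proof (Hs _ 1 Hp Rlt_0_1). pose proof (lambda_mono s (2 / 23) _ 1 L Hp Rlt_0_1).
    pose proof lambda_lt_logmean. lra. }
  assert (T_in : T (29 / 320)) by (intros a b Ha Hb; apply logmean_le_lambda; lra).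
  (* The parameters are negated to turn the infimum into a supremum, so [- m] is the required
     [s0]. *)
  destruct (completeness (fun x => T (- x))) as [m [Hub Hlub]].
  { exists (- (2 / 23)). intros x Hx. pose proof (T_lower _ Hx). lra. }
  { exists (- (29 / 320)). rewrite Ropp_involutive. exact T_in. }
  assert (B1 : - (29 / 320) <= m) by (apply Hub; rewrite Ropp_involutive; exact T_in).
  assert (B2 : m <= - (2 / 23)).
  { apply Hlub. intros x Hx. pose proof (T_lower _ Hx). lra. }
  assert (HT : forall s, T s <-> - m <= s).
  { intros s. split.
    - intros Hs. assert (- s <= m) by (apply Hub; rewrite Ropp_involutive; exact Hs). lra.
    - intros Hs a b Ha Hb. apply Rle_trans with (lambda (- m) a b); [|apply lambda_mono; assumption].
      apply lambda_continuous_le; [lra|assumption|assumption|]. intros r Hr.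
      (* [T] is upward closed by monotonicity. If it failed at [r], then [r] would be a lower bound
         of [T] larger than its infimum [- m]. *)
      destruct (Classical_Prop.classic (T r)) as [Tr|NT]; [apply Tr; assumption|exfalso].
      assert (m <= - r); [|lra]. apply Hlub. intros x Hx. apply Rnot_lt_le. intros L.
      apply NT. intros u v Hu Hv. apply Rle_trans with (lambda (- x) u v); [apply Hx; assumption|].
      apply lambda_mono; [lra|assumption|assumption]. }
  assert (HI : forall s, s <= 1 -> forall a b, 0 < a -> 0 < b -> lambda s a b <= identric a b).
  { intros s Hs a b Ha Hb. apply Rle_trans with (lambda 1 a b); [apply lambda_mono; assumption|].
    apply lambda_1_le_identric; assumption. }
  exists (- m). split; [lra|]. split; [|split].
  - intros s Hs a b Ha Hb. split; [apply (proj2 (HT s)); [lra|assumption|assumption]|].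
    apply HI; [lra|assumption|assumption].
  - exact HT.
  - intros s. split; [apply le_1_of_lambda_le_identric|apply HI].
Qed.
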